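(* Let $\Sigma=(S, E, I, \mathrm{Tran})$ be a state space, with $E$ equipped with a total order, and let $F:K_*(\Sigma)\to\mathrm{Ab}$ be a functor. If $M(E,I)$ is locally finite-dimensional, then $H_n(\Sigma, F)\cong H_n(Q_*(U\circ\Sigma), \overline{F})$ for all $n\geq 0$.
   Context: A state space $\Sigma=(S,E,I,\mathrm{Tran})$ consists of sets $S$ (states) and $E$ (events), a subset $\mathrm{Tran}\subseteq S\times E\times S$ (transitions), and an irreflexive symmetric relation $I\subseteq E\times E$ such that (i) if $(s,e,s'),(s,e,s'')\in\mathrm{Tran}$ then $s'=s''$; (ii) for any $(e_1,e_2)\in I$ and $(s,e_1,s_1),(s_1,e_2,v)\in\mathrm{Tran}$ there is $s_2\in S$ with $(s,e_2,s_2),(s_2,e_1,v)\in\mathrm{Tran}$. $M(E,I)$ is the monoid with generators $E$ and relations $ab=ba$ for $(a,b)\in I$ (free partially commutative monoid; $E$ may be infinite). It is locally finite-dimensional if every maximal subset of $E$ of mutually commuting generators (pairwise in $I$) is finite; equivalently, the graph $(E,I)$ has no infinite clique. The state space $\Sigma$ is regarded as the pointed set $S_*=S\sqcup\{\star\}$ with the right action of $M(E,I)$ by pointed maps determined by $s\cdot e=s'$ if $(s,e,s')\in\mathrm{Tran}$, $s\cdot e=\star$ if there is no such $s'$, and $\star\cdot e=\star$. $U\circ\Sigma$ denotes the underlying right $M(E,I)$-set $S_*$ (forgetting the base point). The category $K_*(\Sigma)$ has object set $S_*$, morphisms $s_1\stackrel{\mu}\to s_2$ with $\mu\in M(E,I)$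 and $s_1\cdot\mu=s_2$, and composition of $s_1\stackrel{\mu_1}\to s_2$ followed by $s_2\stackrel{\mu_2}\to s_3$ equal to $s_1\stackrel{\mu_1\mu_2}\to s_3$. For $F:K_*(\Sigma)\to\mathrm{Ab}$, $H_n(\Sigma,F)=\varinjlim_n^{K_*(\Sigma)}F$, where $\varinjlim_n$ is the $n$-th left derived functor of the colimit functor $\mathrm{Ab}^{K_*(\Sigma)}\to\mathrm{Ab}$. $\Box_+$ is the category whose objects are the posets $\mathbb{I}^n=\{0,1\}^n$ ($n\ge 0$) and whose morphisms are compositions of the maps $\delta_i^{k,\varepsilon}:\mathbb{I}^{k-1}\to\mathbb{I}^k$ inserting $\varepsilon\in\{0,1\}$ at the $i$-th place. A semicubical set (the same as a semi-regular higher-dimensional automaton) is a functor $X:\Box_+^{op}\to\mathrm{Set}$, with $X_n=X(\mathbb{I}^n)$, $\partial_i^{n,\varepsilon}=X(\delta_i^{n,\varepsilon})$. The category $\Box_+/X$ has objects the elements of $\coprod_n X_n$; morphisms from $\sigma\in X_m$ to $\tau\in X_n$ are triples $(\alpha,\sigma,\tau)$ with $\alpha\in\Box_+(\mathbb{I}^m,\mathbb{I}^n)$, $X(\alpha)(\tau)=\sigma$. A homological system on $X$ is a functor $G:(\Box_+/X)^{op}\to\mathrm{Ab}$. $H_n(X,G)$ is the $n$-th homology group of the complex $C_n(X,G)=\bigoplus_{\sigma\in X_n}G(\sigma)$ with $d_n=\sum_{i=1}^n(-1)^i(d_i^{n,1}-d_i^{n,0})$, where $d_i^{n,\varepsilon}$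 maps the summand $G(\sigma)$ to the summand $G(\partial_i^{n,\varepsilon}\sigma)$ by $G(\delta_i^{n,\varepsilon},\partial_i^{n,\varepsilon}(\sigma),\sigma)$. For a right $M(E,I)$-set $X$ and a total order on $E$, $Q_*X$ is the semicubical set with $Q_nX=\{(x,a_1,\ldots,a_n): x\in X,\ a_i\in E,\ a_1<\cdots<a_n,\ (a_i,a_j)\in I \text{ for } i<j\}$ and $\partial_i^{n,\varepsilon}(x,a_1,\ldots,a_n)=(x\cdot a_i^{\varepsilon},a_1,\ldots,\widehat{a_i},\ldots,a_n)$, where $a_i^0=1$, $a_i^1=a_i$. The homological system $\overline F$ on $Q_*(U\circ\Sigma)$ is given by $\overline F(x,a_1,\ldots,a_n)=F(x)$ and $\overline F(\delta_i^{n,\varepsilon},\partial_i^{n,\varepsilon}(\sigma),\sigma)=F(x\stackrel{a_i^\varepsilon}\to x\cdot a_i^\varepsilon)$ for $\sigma=(x,a_1,\ldots,a_n)$. *)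

(* Defs.v *)
From HB Require Import structures.
From mathcomp Require Import all_boot all_order all_algebra.
From mathcomp Require Import zify finmap boolp classical_sets functions cardinality fsbigop.

Set Implicit Arguments.
Unset Strict Implicit.
Unset Printing Implicit Defensive.

Import GRing.Theory.
Local Open Scope classical_set_scope.
Local Open Scope ring_scope.

Definition zmod_iso (A B : zmodType) : Prop :=
  exists f : {additive A -> B}, bijective f.

Section DirectSum.
Variables (T : Type) (G : T -> zmodType).

Record dsum := DSum {
  dsum_val :> forall t, G t;
  dsum_finite : finite_set [set t | dsum_val t <> 0] }.

HB.instance Definition _ := gen_eqMixin dsum.
HB.instance Definition _ := gen_choiceMixin dsum.

Lemma dsum_eqP (f g : dsum) : (forall t, f t = g t) -> f = g.
Proof.
case: f g => [f hf] [g hg] /= fg; have {}fg : f = g by exact: functional_extensionality_dep.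
by case: _ / fg hg => hg; congr DSum; exact: Prop_irrelevance.
Qed.

Fact dsum0_subproof : finite_set [set t | (0 : G t) <> 0].
Proof. by apply: (sub_finite_set _ (finite_set0 T)) => t. Qed.
Definition dsum0 := DSum dsum0_subproof.

Fact dsum_opp_subproof (f : dsum) : finite_set [set t | - f t <> 0].
Proof.
by apply: (sub_finite_set _ (dsum_finite f)) => t /= h ft; apply: h; rewrite ft oppr0.
Qed.
Definition dsum_opp f := DSum (dsum_opp_subproof f).

Fact dsum_add_subproof (f g : dsum) : finite_set [set t | f t + g t <> 0].
Proof.
have h : finite_set ([set t | f t <> 0] `|` [set t | g t <> 0]).
  by rewrite finite_setU; split; exact: dsum_finite.
apply: (sub_finite_set _ h) => t /= fg.
have [ft|] := pselect (f t = 0); last by left.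
by right => gt; apply: fg; rewrite ft gt addr0.
Qed.
Definition dsum_add f g := DSum (dsum_add_subproof f g).

Fact dsum_addA : associative dsum_add.
Proof. by move=> f g h; apply: dsum_eqP => t /=; rewrite addrA. Qed.
Fact dsum_addC : commutative dsum_add.
Proof. by move=> f g; apply: dsum_eqP => t /=; rewrite addrC. Qed.
Fact dsum_add0 : left_id dsum0 dsum_add.
Proof. by move=> f; apply: dsum_eqP => t /=; rewrite add0r. Qed.
Fact dsum_addN : left_inverse dsum0 dsum_opp dsum_add.
Proof. by move=> f; apply: dsum_eqP => t /=; rewrite addNr. Qed.

HB.instance Definition _ :=
  GRing.isZmodule.Build dsum dsum_addA dsum_addC dsum_add0 dsum_addN.

Lemma dsumD (f g : dsum) t : (f + g) t = f t + g t. Proof. by []. Qed.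
Lemma dsumN (f : dsum) t : (- f) t = - f t. Proof. by []. Qed.
Lemma dsum0E t : (0 : dsum) t = 0. Proof. by []. Qed.

Lemma dsum_sumE (J : Type) (r : seq J) (F : J -> dsum) t :
  (\sum_(j <- r) F j) t = \sum_(j <- r) F j t.
Proof. by elim/big_ind2: _ => // f1 x1 f2 x2 <- <-. Qed.

Section Single.
Variable t : T.

Definition single_val (x : G t) (t' : T) : G t' :=
  match pselect (t = t') with
  | left e => eq_rect t G x t' e
  | right _ => 0
  end.

Lemma single_valE x : single_val x t = x.
Proof. by rewrite /single_val; case: pselect => // e; rewrite (Prop_irrelevance e erefl). Qed.

Lemma single_valN x t' : t <> t' -> single_val x t' = 0.
Proof. by rewrite /single_val; case: pselect. Qed.

Fact single_subproof x : finite_set [set t' | single_val x t' <> 0].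
Proof.
apply: (sub_finite_set _ (finite_set1 t)) => t' /= h.
by apply: contrapT => tt'; apply: h; apply: single_valN => /esym.
Qed.
Definition dsum_in x : dsum := DSum (single_subproof x).

Fact dsum_in_additive : zmod_morphism dsum_in.
Proof.
move=> x y; apply: dsum_eqP => t'; rewrite dsumD dsumN /=.
have [<-|ne] := pselect (t = t'); first by rewrite !single_valE.
by rewrite !single_valN // subr0.
Qed.
HB.instance Definition _ := GRing.isZmodMorphism.Build (G t) dsum dsum_in dsum_in_additive.
End Single.

Lemma dsum_inE t x : dsum_in x t = x :> G t. Proof. exact: single_valE. Qed.

Section Lift.
Variables (A : zmodType) (h : forall t, {additive G t -> A}).

Definition dsum_lift (f : dsum) : A :=
  \sum_(t \in [set: {classic T}]) h t (f t).

Lemma dsum_lift_on (D : set {classic T}) (f : dsum) :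
  (forall t, f t <> 0 -> D t) -> dsum_lift f = \sum_(t \in D) h t (f t).
Proof.
move=> fD; rewrite /dsum_lift; apply/esym/fsbig_widen => // t [_ /= nDt].
suff -> : f t = 0 by rewrite raddf0.
by apply: contrapT => ft; exact: nDt (fD _ ft).
Qed.

Fact dsum_lift_additive : zmod_morphism dsum_lift.
Proof.
suff D : {morph dsum_lift : f g / f + g}.
  by move=> f g; apply: (addIr (dsum_lift g)); rewrite -D !addrNK.
move=> f g; pose D : set {classic T} := [set t | f t <> 0] `|` [set t | g t <> 0].
have Dfin : finite_set D by rewrite finite_setU; split; exact: dsum_finite.
rewrite !(@dsum_lift_on D) => [|t gt|t ft|t /= fgt].
- by rewrite -fsbig_split //; apply: eq_fsbigr => t _; rewrite raddfD.
- by right.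
- by left.
- have [ft|] := pselect (f t = 0); last by left.
  by right => gt; apply: fgt; rewrite ft gt addr0.
Qed.
HB.instance Definition _ :=
  GRing.isZmodMorphism.Build dsum A dsum_lift dsum_lift_additive.

Lemma dsum_liftE t (x : G t) : dsum_lift (dsum_in x) = h t x.
Proof.
rewrite (@dsum_lift_on [set t]) => [|t' /= ne].
  by rewrite fsbig_set1 dsum_inE.
by apply: contrapT => tt'; apply: ne; apply: single_valN => /esym.
Qed.
End Lift.

Lemma dsum_decomp (f : dsum) :
  f = \sum_(t <- fset_set ([set t | f t <> 0] : set {classic T})) dsum_in (f t).
Proof.
apply: dsum_eqP => t0; rewrite dsum_sumE.
have fin : finite_set ([set t | f t <> 0] : set {classic T}) := dsum_finite f.
have [ft0|ft0] := pselect (f t0 = 0).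
  rewrite big1_seq // => t /= tf.
  have [e|] := pselect (t = t0); last exact: single_valN.
  by move: tf; rewrite e in_fset_set // inE /= ft0.
rewrite (big_rem (t0 : {classic T})) /=; last by rewrite in_fset_set // inE.
rewrite single_valE big1_seq ?addr0 // => t /= tf.
by apply: single_valN => e; move: tf; rewrite e mem_rem_uniqF // fset_uniq.
Qed.

Lemma dsum_ext (A : zmodType) (u v : {additive dsum -> A}) :
  (forall t (x : G t), u (dsum_in x) = v (dsum_in x)) -> u =1 v.
Proof.
by move=> uv f; rewrite (dsum_decomp f) !raddf_sum; apply: eq_bigr => t _.
Qed.
End DirectSum.

Section Kernel.
Variables (A B : zmodType) (f : {additive A -> B}).

Definition ker_pred : {pred A} := fun x => f x == 0.
Fact ker_zmod_closed : zmod_closed ker_pred.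
Proof.
split=> [|x y]; rewrite !unfold_in /ker_pred ?raddf0 //.
by move=> /eqP fx /eqP fy; rewrite raddfB fx fy subr0.
Qed.
HB.instance Definition _ := GRing.isZmodClosed.Build A ker_pred ker_zmod_closed.

Record ker := Ker { ker_val :> A; ker_valP : ker_val \in ker_pred }.
HB.instance Definition _ := [isSub for ker_val].
HB.instance Definition _ := [Choice of ker by <:].
HB.instance Definition _ := [SubChoice_isSubZmodule of ker by <:].

Lemma ker_valE (x : ker) : f (ker_val x) = 0.
Proof. by apply/eqP; exact: (ker_valP x). Qed.

Fact ker_val_additive : zmod_morphism ker_val.
Proof. exact: (raddfB (val : ker -> A)). Qed.
HB.instance Definition _ := GRing.isZmodMorphism.Build ker A ker_val ker_val_additive.

Section Factor.
Variables (C : zmodType) (g : {additive C -> A}) (fg0 : forall x, f (g x) = 0).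

Fact to_ker_subproof x : g x \in ker_pred.
Proof. by rewrite unfold_in /ker_pred fg0. Qed.
Definition to_ker x : ker := Ker (to_ker_subproof x).
Fact to_ker_additive : zmod_morphism to_ker.
Proof. by move=> x y; apply: val_inj; rewrite raddfB /= raddfB. Qed.
HB.instance Definition _ := GRing.isZmodMorphism.Build C ker to_ker to_ker_additive.
End Factor.
End Kernel.

Section Cokernel.
Variables (A B : zmodType) (f : {additive A -> B}).

Definition im_pred : {pred B} := fun y => `[< exists x, f x = y >].
Fact im_zmod_closed : zmod_closed im_pred.
Proof.
split=> [|y z]; rewrite !unfold_in; first by apply/asboolP; exists 0; rewrite raddf0.
move=> /asboolP[x <-] /asboolP[x' <-].
by apply/asboolP; exists (x - x'); rewrite raddfB.
Qed.
HB.instance Definition _ := GRing.isZmodClosed.Build B im_pred im_zmod_closed.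

Definition coker : zmodType := Quotient.quot im_pred.
Definition coker_pi (y : B) : coker := (\pi_(Quotient.quot im_pred) y)%qT.

Fact coker_pi_additive : zmod_morphism coker_pi.
Proof. exact: (raddfB (\pi_(Quotient.quot im_pred))%qT). Qed.
HB.instance Definition _ := GRing.isZmodMorphism.Build B coker coker_pi coker_pi_additive.

Lemma coker_pi_surj (z : coker) : exists y, coker_pi y = z.
Proof. by exists (repr (z : Quotient.quot im_pred)); exact: reprK. Qed.

Lemma coker_pi_eq0 y : coker_pi y = 0 <-> exists x, f x = y.
Proof.
rewrite -[0](raddf0 coker_pi) /coker_pi; split.
  by move/eqP; rewrite -Quotient.idealrBE subr0 unfold_in => /asboolP.
by move=> h; apply/eqP; rewrite -Quotient.idealrBE subr0 unfold_in; apply/asboolP.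
Qed.

Section Lift.
Variables (C : zmodType) (g : {additive B -> C}) (gf0 : forall x, g (f x) = 0).

(* The hypothesis is an argument so that the additive structure below can be
   inferred. *)
Definition coker_lift of (forall x, g (f x) = 0) := fun z : coker =>
  g (repr (z : Quotient.quot im_pred)).

Lemma coker_liftE y : coker_lift gf0 (coker_pi y) = g y.
Proof.
apply/eqP; rewrite -subr_eq0 -raddfB; apply/eqP.
set y' := repr _; have : coker_pi (y' - y) = 0.
  by rewrite raddfB; apply/eqP; rewrite subr_eq0; apply/eqP; exact: reprK.
by case/coker_pi_eq0 => x <-.
Qed.

Fact coker_lift_additive : zmod_morphism (coker_lift gf0).
Proof.
move=> z w; have [[y <-] [y' <-]] := (coker_pi_surj z, coker_pi_surj w).
by rewrite -raddfB !coker_liftE raddfB.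
Qed.
HB.instance Definition _ :=
  GRing.isZmodMorphism.Build coker C (coker_lift gf0) coker_lift_additive.
End Lift.
End Cokernel.

Record chain_complex := ChainComplex {
  chain :> nat -> zmodType;
  bd : forall n, {additive chain n.+1 -> chain n};
  bd_bd : forall n x, bd n (bd n.+1 x) = 0 }.

Section Homology.
Variable C : chain_complex.

Definition cycles (n : nat) : zmodType :=
  match n with 0 => C 0 | n'.+1 => ker (bd C n') end.

Definition bd_cycles (n : nat) : {additive C n.+1 -> cycles n} :=
  match n with 0 => bd C 0 | n'.+1 => to_ker (@bd_bd C n') end.

Definition homology (n : nat) : zmodType := coker (bd_cycles n).
End Homology.

(* Composition is written in diagrammatic order: [f ;; g] is [f] followed by
   [g]. *)
Record category := Category {
  obj :> Type;
  hom : obj -> obj -> Type;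
  idm : forall a, hom a a;
  hcomp : forall a b c, hom a b -> hom b c -> hom a c;
  hcomp_idl : forall a b (f : hom a b), hcomp (idm a) f = f;
  hcomp_idr : forall a b (f : hom a b), hcomp f (idm b) = f;
  hcompA : forall a b c d (f : hom a b) (g : hom b c) (h : hom c d),
    hcomp f (hcomp g h) = hcomp (hcomp f g) h }.
Arguments hom {c} _ _ : rename.
Arguments idm {c} a : rename.
Arguments hcomp {c a b c0} f g : rename.
Notation "f ;; g" := (hcomp f g) (at level 50, left associativity).

Definition opposite (C : category) : category :=
  @Category C (fun a b => @hom C b a) (fun a => idm a)
    (fun a b c f g => g ;; f)
    (fun a b f => hcomp_idr f) (fun a b f => hcomp_idl f)
    (fun a b c d f g h => esym (hcompA h g f)).

Record ab_functor (C : category) := AbFunctor {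
  fobj :> C -> zmodType;
  fmap : forall a b, hom a b -> {additive fobj a -> fobj b};
  fmap_id : forall a x, fmap (idm a) x = x;
  fmap_comp : forall a b c (f : hom a b) (g : hom b c) x,
    fmap (f ;; g) x = fmap g (fmap f x) }.
Arguments fmap {C} _ {a b} f.

Record ab_nat (C : category) (F G : ab_functor C) := AbNat {
  ncomp :> forall a, {additive F a -> G a};
  ncomp_nat : forall a b (f : hom a b) x,
    ncomp b (fmap F f x) = fmap G f (ncomp a x) }.
Arguments ncomp {C F G} _ a.

Definition ab_nat_eq (C : category) (F G : ab_functor C) (u v : ab_nat F G) :=
  forall a x, u a x = v a x.

Definition ab_nat_comp (C : category) (F G H : ab_functor C)
    (u : ab_nat F G) (v : ab_nat G H) : ab_nat F H.
Proof.
refine (@AbNat C F H (fun a => v a \o u a) _) => a b f x /=.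
by rewrite !ncomp_nat.
Defined.

Definition ab_epi (C : category) (F G : ab_functor C) (p : ab_nat F G) : Prop :=
  forall (H : ab_functor C) (u v : ab_nat G H),
    ab_nat_eq (ab_nat_comp p u) (ab_nat_comp p v) -> ab_nat_eq u v.

Definition ab_projective (C : category) (P : ab_functor C) : Prop :=
  forall (F G : ab_functor C) (p : ab_nat F G), ab_epi p ->
  forall f : ab_nat P G, exists g : ab_nat P F, ab_nat_eq (ab_nat_comp g p) f.

(* Exactness in the functor category is exactness at every object. *)
Record projective_resolution (C : category) (F : ab_functor C) := ProjRes {
  res : nat -> ab_functor C;
  res_bd : forall n, ab_nat (res n.+1) (res n);
  res_aug : ab_nat (res 0) F;
  res_proj : forall n, ab_projective (res n);
  res_aug_surj : forall a y, exists x, res_aug a x = y;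
  res_aug_exact : forall a x, res_aug a x = 0 <-> exists y, res_bd 0 a y = x;
  res_exact : forall n a x,
    res_bd n a x = 0 <-> exists y, res_bd n.+1 a y = x }.

Section Colimit.
Variable C : category.

Definition arrow := {a : C & {b : C & hom a b}}.
Definition arrow_src (e : arrow) : C := projT1 e.
Definition arrow_tgt (e : arrow) : C := projT1 (projT2 e).
Definition arrow_hom (e : arrow) : hom (arrow_src e) (arrow_tgt e) :=
  projT2 (projT2 e).

Section Object.
Variable F : ab_functor C.

Section Relation.
Variable e : arrow.
Definition colim_rel1 (x : F (arrow_src e)) : dsum F :=
  dsum_in (fmap F (arrow_hom e) x) - dsum_in x.
Fact colim_rel1_additive : zmod_morphism colim_rel1.
Proof.
move=> x y; rewrite /colim_rel1 (raddfB (fmap F _)) !(raddfB (@dsum_in _ F _)).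
by rewrite !opprD !opprK addrACA.
Qed.
HB.instance Definition _ :=
  GRing.isZmodMorphism.Build (F (arrow_src e)) (dsum F) colim_rel1 colim_rel1_additive.
End Relation.

Definition colim_rel : {additive dsum (fun e : arrow => F (arrow_src e)) -> dsum F} :=
  dsum_lift (fun e => @colim_rel1 e).

Lemma colim_relE (e : arrow) (x : F (arrow_src e)) :
  colim_rel (@dsum_in _ (fun e => F (arrow_src e)) e x) = colim_rel1 x.
Proof. exact: dsum_liftE. Qed.

(* The quotient of the direct sum of all [F a] by the relations
   [x ~ F(f)(x)], for [f : a -> b] and [x] in [F a]. *)
Definition colim : zmodType := coker colim_rel.

Definition colim_in (a : C) : {additive F a -> colim} :=
  coker_pi colim_rel \o @dsum_in C F a.

Lemma colim_inE a b (f : hom a b) x : colim_in b (fmap F f x) = colim_in a x.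
Proof.
apply/eqP; rewrite -subr_eq0 /= -raddfB; apply/eqP/coker_pi_eq0.
pose e : arrow := existT _ a (existT _ b f).
by exists (@dsum_in _ (fun e => F (arrow_src e)) e x); exact: dsum_liftE.
Qed.

Section Universal.
Variables (A : zmodType) (h : forall a, {additive F a -> A}).
Hypothesis hF : forall a b (f : hom a b) x, h b (fmap F f x) = h a x.

Fact colim_desc_subproof x : dsum_lift h (colim_rel x) = 0.
Proof.
suff /(_ x) : (dsum_lift h \o colim_rel) =1 (\0 : {additive _ -> A}) by [].
apply: dsum_ext => e y; apply: (etrans (congr1 (dsum_lift h) (colim_relE y))).
by rewrite /colim_rel1 raddfB /= !dsum_liftE hF subrr.
Qed.
Definition colim_desc : {additive colim -> A} := coker_lift colim_desc_subproof.

Lemma colim_descE a x : colim_desc (colim_in a x) = h a x.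
Proof. exact: etrans (coker_liftE colim_desc_subproof _) (dsum_liftE h x). Qed.
End Universal.

Lemma colim_ext (A : zmodType) (u v : {additive colim -> A}) :
  (forall a x, u (colim_in a x) = v (colim_in a x)) -> u =1 v.
Proof.
move=> uv z; have [y <-] := coker_pi_surj z.
exact: (dsum_ext (u := u \o coker_pi _) (v := v \o coker_pi _)).
Qed.
End Object.

Section Map.
Variables (F G : ab_functor C) (u : ab_nat F G).

Fact colim_map_subproof a b (f : hom a b) x :
  (colim_in G b \o u b) (fmap F f x) = (colim_in G a \o u a) x.
Proof. exact: etrans (congr1 (colim_in G b) (ncomp_nat u f x)) (colim_inE f _). Qed.

Definition colim_map : {additive colim F -> colim G} :=
  colim_desc colim_map_subproof.

Lemma colim_mapE a x : colim_map (colim_in F a x) = colim_in G a (u a x).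
Proof. exact: colim_descE. Qed.
End Map.

Section Complex.
Variables (F : ab_functor C) (P : projective_resolution F).

Fact colim_complex_subproof n x :
  colim_map (res_bd P n) (colim_map (res_bd P n.+1) x) = 0.
Proof.
have e a y : colim_map (res_bd P n) (colim_map (res_bd P n.+1) (colim_in _ a y)) = 0.
  rewrite !colim_mapE (_ : res_bd P n a _ = 0) ?raddf0 //.
  by apply/res_exact; exists y.
exact: (colim_ext (u := colim_map (res_bd P n) \o colim_map (res_bd P n.+1))
                  (v := \0)).
Qed.

Definition colim_complex : chain_complex :=
  ChainComplex (chain := fun n => colim (res P n))
    (bd := fun n => colim_map (res_bd P n)) colim_complex_subproof.
End Complex.
End Colimit.

Section Cokernel_functor.
Variables (C : category) (F G : ab_functor C) (p : ab_nat F G).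

Section Map.
Variables (a b : C) (f : hom a b).
Fact coker_map_subproof x : (coker_pi (p b) \o fmap G f) (p a x) = 0.
Proof. by rewrite /= -ncomp_nat; apply/coker_pi_eq0; exists (fmap F f x). Qed.
Definition coker_map : {additive coker (p a) -> coker (p b)} :=
  coker_lift coker_map_subproof.
Lemma coker_mapE y : coker_map (coker_pi (p a) y) = coker_pi (p b) (fmap G f y).
Proof. exact: coker_liftE. Qed.
End Map.

Fact coker_map_id a z : coker_map (idm a) z = z.
Proof. by have [y <-] := coker_pi_surj z; rewrite coker_mapE fmap_id. Qed.
Fact coker_map_comp a b c (f : hom a b) (g : hom b c) z :
  coker_map (f ;; g) z = coker_map g (coker_map f z).
Proof. by have [y <-] := coker_pi_surj z; rewrite !coker_mapE fmap_comp. Qed.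
Definition coker_functor : ab_functor C := AbFunctor coker_map_id coker_map_comp.

Definition coker_nat : ab_nat G coker_functor :=
  @AbNat C G coker_functor (fun a => coker_pi (p a))
    (fun a b f x => esym (coker_mapE f x)).

Definition zero_nat : ab_nat G coker_functor.
Proof.
by refine (@AbNat C G coker_functor (fun a => \0) _) => a b f x; rewrite raddf0.
Defined.

Lemma ab_epi_surj : ab_epi p -> forall a y, exists x, p a x = y.
Proof.
move=> epi a y; apply/coker_pi_eq0.
apply: (epi coker_functor coker_nat zero_nat) => b x.
by apply/coker_pi_eq0; exists x.
Qed.
End Cokernel_functor.

Lemma ab_surj_epi (C : category) (F G : ab_functor C) (p : ab_nat F G) :
  (forall a y, exists x, p a x = y) -> ab_epi p.
Proof. by move=> surj H u v uv a y; have [x <-] := surj a y; exact: uv. Qed.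

Section Kernel_functor.
Variables (C : category) (F G : ab_functor C) (p : ab_nat F G).

Section Map.
Variables (a b : C) (f : hom a b).
Fact ker_map_subproof x : p b ((fmap F f \o @ker_val _ _ (p a)) x) = 0.
Proof. by rewrite /= ncomp_nat ker_valE raddf0. Qed.
Definition ker_map : {additive ker (p a) -> ker (p b)} := to_ker ker_map_subproof.
End Map.

Fact ker_map_id a x : ker_map (idm a) x = x.
Proof. by apply: val_inj; exact: fmap_id. Qed.
Fact ker_map_comp a b c (f : hom a b) (g : hom b c) x :
  ker_map (f ;; g) x = ker_map g (ker_map f x).
Proof. by apply: val_inj; exact: fmap_comp. Qed.
Definition ker_functor : ab_functor C := AbFunctor ker_map_id ker_map_comp.

Definition ker_nat : ab_nat ker_functor F :=
  @AbNat C ker_functor F (fun a => @ker_val _ _ (p a)) (fun a b f x => erefl).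
End Kernel_functor.

Section Multiples.
Variables (A : zmodType) (y : A).
Definition multiples (k : int) : A := y *~ k.
Fact multiples_additive : zmod_morphism multiples.
Proof. by move=> k l; exact: mulrzBr. Qed.
HB.instance Definition _ := GRing.isZmodMorphism.Build int A multiples multiples_additive.
End Multiples.

Lemma dsum_int_ext (T : Type) (A : zmodType) (u v : {additive dsum (fun _ : T => int) -> A}) :
  (forall t, u (@dsum_in T (fun _ => int) t 1) = v (@dsum_in T (fun _ => int) t 1)) -> u =1 v.
Proof.
move=> uv; apply: dsum_ext => t k.
have -> : @dsum_in T (fun _ => int) t k = @dsum_in T (fun _ => int) t 1 *~ k by rewrite -raddfMz intz.
by rewrite !raddfMz uv.
Qed.

Section Free_functor.
Variables (C : category) (F : ab_functor C).

(* [free_functor F] is the direct sum, over the objects [c] and the elements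
   of [F c], of the linearised representable functors Z[hom c -]. *)
Definition free_gen (a : C) := {c : C & (F c * hom c a)%type}.

Definition free_push (a b : C) (f : hom a b) (t : free_gen a) : free_gen b :=
  existT _ (projT1 t) ((projT2 t).1, (projT2 t).2 ;; f).

Local Notation free_obj a := (dsum (fun _ : free_gen a => int)).

Definition free_in (a : C) (t : free_gen a) : int -> free_obj a :=
  @dsum_in (free_gen a) (fun _ => int) t.
HB.instance Definition _ (a : C) (t : free_gen a) :=
  GRing.isZmodMorphism.Build int (free_obj a) (free_in t)
    (@dsum_in_additive (free_gen a) (fun _ => int) t).

Definition free_map (a b : C) (f : hom a b) : {additive free_obj a -> free_obj b} :=
  dsum_lift (fun t => free_in (free_push f t)).

Lemma free_mapE a b (f : hom a b) t k :
  free_map f (free_in t k) = free_in (free_push f t) k.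
Proof. exact: dsum_liftE. Qed.

Fact free_map_id a x : free_map (idm a) x = x.
Proof.
apply: (@dsum_ext _ _ _ (free_map (idm a)) idfun) => t k.
apply: etrans (free_mapE _ _ _) _; rewrite /free_push hcomp_idr.
by case: t => c [].
Qed.

Fact free_map_comp a b c (f : hom a b) (g : hom b c) x :
  free_map (f ;; g) x = free_map g (free_map f x).
Proof.
apply: (@dsum_ext _ _ _ (free_map (f ;; g)) (free_map g \o free_map f)) => t k.
apply: etrans (free_mapE _ _ _) _.
apply: esym; apply: etrans (congr1 (free_map g) (free_mapE _ _ _)) _.
by rewrite free_mapE /free_push /= hcompA.
Qed.

Definition free_functor : ab_functor C :=
  @AbFunctor C (fun a => free_obj a) free_map free_map_id free_map_comp.

Section Lift.
Variables (G : ab_functor C) (y : forall c, F c -> G c).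

Definition free_lift_map (a : C) : {additive free_functor a -> G a} :=
  dsum_lift (fun t : free_gen a => multiples (fmap G (projT2 t).2 (y (projT2 t).1))).

Lemma free_lift_mapE a t k :
  free_lift_map a (free_in t k) = fmap G (projT2 t).2 (y (projT2 t).1) *~ k.
Proof. exact: dsum_liftE. Qed.

Fact free_lift_nat a b (f : hom a b) x :
  free_lift_map b (fmap free_functor f x) = fmap G f (free_lift_map a x).
Proof.
apply: (@dsum_ext _ _ _ (free_lift_map b \o free_map f)
          (fmap G f \o free_lift_map a)) => t k.
apply: etrans (congr1 (free_lift_map b) (free_mapE _ _ _)) _.
apply: esym; apply: etrans (congr1 (fmap G f) (free_lift_mapE _ _)) _.
by rewrite free_lift_mapE raddfMz /= fmap_comp.
Qed.

Definition free_lift : ab_nat free_functor G := AbNat free_lift_nat.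
End Lift.

Definition free_one (c : C) (x : F c) : free_functor c :=
  free_in (existT _ c (x, idm c)) 1.

Lemma free_functor_ext (G : ab_functor C) (u v : ab_nat free_functor G) :
  (forall c x, u c (free_one x) = v c (free_one x)) -> ab_nat_eq u v.
Proof.
move=> uv a; apply: (@dsum_int_ext _ _ (u a) (v a)) => -[c [x f]].
have -> : @dsum_in (free_gen a) (fun _ => int) (existT _ c (x, f)) 1
  = fmap free_functor f (free_one x).
  apply: esym; apply: etrans (free_mapE _ _ _) _.
  by rewrite /free_push /= hcomp_idl.
by rewrite !ncomp_nat uv.
Qed.

Lemma free_liftE (G : ab_functor C) (y : forall c, F c -> G c) c x :
  free_lift y c (free_one x) = y c x.
Proof. by apply: etrans (free_lift_mapE _ _ _) _; rewrite /= fmap_id. Qed.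

Lemma free_projective : ab_projective free_functor.
Proof.
move=> G H p /ab_epi_surj surj f.
pose y c (x : F c) : G c := sval (cid (surj c (f c (free_one x)))).
exists (free_lift y); apply: free_functor_ext => c x /=.
by rewrite free_liftE /y; case: cid.
Qed.

Definition free_counit : ab_nat free_functor F := free_lift (fun c x => x).

Lemma free_counit_surj a y : exists x, free_counit a x = y.
Proof. by exists (free_one y); exact: free_liftE. Qed.
End Free_functor.

Section Standard_resolution.
Variables (C : category) (F : ab_functor C).

(* [syzygy n.+1] is the kernel of the free cover of [syzygy n]. *)
Fixpoint syzygy (n : nat) : ab_functor C :=
  match n with 0 => F | n'.+1 => ker_functor (free_counit (syzygy n')) end.

Definition std_bd (n : nat) :
    ab_nat (free_functor (syzygy n.+1)) (free_functor (syzygy n)) :=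
  ab_nat_comp (free_counit (syzygy n.+1)) (ker_nat (free_counit (syzygy n))).

Lemma std_bd_im n a x :
  free_counit (syzygy n) a x = 0 <-> exists y, std_bd n a y = x.
Proof.
split=> [/eqP x0|[y <-]]; last exact: ker_valE.
have [y yx] := free_counit_surj (Ker x0 : syzygy n.+1 a).
by exists y; exact: (congr1 (@ker_val _ _ _) yx).
Qed.

Lemma std_bd_exact n a x :
  std_bd n a x = 0 <-> exists y, std_bd n.+1 a y = x.
Proof.
rewrite -std_bd_im; split=> [x0|x0]; first exact: val_inj.
exact: (congr1 (@ker_val _ _ _) x0).
Qed.

Definition std_resolution : projective_resolution F :=
  ProjRes (fun n => @free_projective C (syzygy n)) (@free_counit_surj C F)
    (@std_bd_im 0) std_bd_exact.
End Standard_resolution.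

(* The [n]-th left derived functor of the colimit functor; by the comparison
   theorem any other projective resolution of [F] gives an isomorphic group. *)
Definition colim_derived (C : category) (F : ab_functor C) (n : nat) : zmodType :=
  homology (colim_complex (std_resolution F)) n.

Section Trace.
Variables (E : choiceType) (I : E -> E -> Prop).

(* The congruence on words generated by ab = ba for (a, b) in I. *)
Inductive trace_eq : seq E -> seq E -> Prop :=
| trace_swap u a b v : I a b -> trace_eq (u ++ a :: b :: v) (u ++ b :: a :: v)
| trace_refl u : trace_eq u u
| trace_sym u v : trace_eq u v -> trace_eq v u
| trace_trans u v w : trace_eq u v -> trace_eq v w -> trace_eq u w.

Definition trace_eqb (u v : seq E) : bool := `[< trace_eq u v >].

Fact trace_eqb_equiv : equiv_class_of trace_eqb.
Proof.
split=> [u|u v|v u w].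
- exact/asboolP/trace_refl.
- by apply: asbool_equiv_eq; split; exact: trace_sym.
- move=> /asboolP uv /asboolP vw; apply/asboolP; exact: trace_trans uv vw.
Qed.
Canonical trace_equiv := EquivRelPack trace_eqb_equiv.

Definition trace := {eq_quot trace_equiv}%qT.
HB.instance Definition _ := Choice.on trace.
HB.instance Definition _ := EqQuotient.on trace.

Definition trace_of (u : seq E) : trace := (\pi_trace u)%qT.

Lemma trace_ofP u v : trace_of u = trace_of v <-> trace_eq u v.
Proof. by split=> [/eqmodP/asboolP|uv]; last exact/eqmodP/asboolP. Qed.

Lemma trace_ofK (x : trace) : trace_of (repr x) = x.
Proof. exact: reprK. Qed.

Lemma trace_eq_cat u u' v v' :
  trace_eq u u' -> trace_eq v v' -> trace_eq (u ++ v) (u' ++ v').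
Proof.
move=> uu' vv'; apply: (@trace_trans _ (u' ++ v)).
  elim: uu' v {vv'} => [w a b w' ab|w|w w' _ IH|w w' w'' _ IH _ IH'] v.
  - by rewrite -!catA /=; exact: trace_swap.
  - exact: trace_refl.
  - exact: trace_sym (IH v).
  - exact: trace_trans (IH v) (IH' v).
elim: vv' => [w a b w' ab|w|w w' _ IH|w w' w'' _ IH _ IH'].
- by rewrite !catA; exact: trace_swap.
- exact: trace_refl.
- exact: trace_sym.
- exact: trace_trans IH IH'.
Qed.

Definition trace_mul (x y : trace) : trace := trace_of (repr x ++ repr y).
Definition trace_one : trace := trace_of [::].

Lemma trace_mulE u v : trace_mul (trace_of u) (trace_of v) = trace_of (u ++ v).
Proof. by apply/trace_ofP/trace_eq_cat; apply/trace_ofP; rewrite trace_ofK. Qed.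

Fact trace_mulA : associative trace_mul.
Proof.
move=> x y z; rewrite -(trace_ofK x) -(trace_ofK y) -(trace_ofK z).
by rewrite !trace_mulE catA.
Qed.
Fact trace_mul1 : left_id trace_one trace_mul.
Proof. by move=> x; rewrite -(trace_ofK x) trace_mulE. Qed.
Fact trace_mulr1 : right_id trace_one trace_mul.
Proof. by move=> x; rewrite -(trace_ofK x) trace_mulE cats0. Qed.

HB.instance Definition _ := isMonoid.Build trace trace_mulA trace_mul1 trace_mulr1.

Lemma trace_of_cat u v : trace_of (u ++ v) = (trace_of u * trace_of v)%g.
Proof. by rewrite -trace_mulE. Qed.
Lemma trace_of_nil : trace_of [::] = 1%g. Proof. by []. Qed.

(* [I] is meant to be irreflexive, hence the condition [a <> b]. *)
Definition commuting_set (A : set E) : Prop :=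
  forall a b, A a -> A b -> a <> b -> I a b.

Definition maximal_commuting_set (A : set E) : Prop :=
  commuting_set A /\ forall B, commuting_set B -> A `<=` B -> A = B.

Definition locally_finite_dimensional : Prop :=
  forall A, maximal_commuting_set A -> finite_set A.

(* Words of pairwise independent letters are determined by their letters. *)
Lemma trace_of_perm (u v : seq E) :
  (forall a b, a \in u -> b \in u -> a <> b -> I a b \/ I b a) ->
  perm_eq u v -> trace_of u = trace_of v.
Proof.
move=> ind /[dup] /perm_size; elim: u v ind => [|a u IH] v ind.
  by move=> /esym/size0nil ->.
move=> sz puv; have av : a \in v by rewrite -(perm_mem puv) mem_head.
case/splitPr: av sz puv => v1 v2 sz puv.
have {}puv : perm_eq u (v1 ++ v2).
  rewrite -(perm_cons a) (perm_trans puv) // -[a :: v2]/([:: a] ++ v2).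
  by rewrite perm_catCA.
have {}IH : trace_of u = trace_of (v1 ++ v2).
  apply: IH (perm_size puv) puv => x y xu yu.
  by apply: ind; rewrite in_cons ?xu ?yu orbT.
rewrite -[a :: u]/([:: a] ++ u) trace_of_cat IH -trace_of_cat /=.
have {}ind x : x \in v1 -> x <> a -> I a x \/ I x a.
  move=> xv ne; apply: ind; rewrite ?mem_head // ?in_cons ?(perm_mem puv) ?mem_cat ?xv ?orbT //.
  by move/esym.
elim: v1 ind {sz puv IH} => [|x v1 IH] //= ind.
rewrite -[x :: v1 ++ a :: v2]/([:: x] ++ (v1 ++ a :: v2)) trace_of_cat -IH; last first.
  by move=> y yv; apply: ind; rewrite in_cons yv orbT.
rewrite -trace_of_cat /=; apply/trace_ofP.
have [->|xa] := pselect (x = a); first exact: trace_refl.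
have [ax|xa'] := ind x (mem_head _ _) xa.
  exact: (@trace_swap [::]).
exact/trace_sym/(@trace_swap [::]).
Qed.
End Trace.

Record right_mset (M : monoidType) := RightMSet {
  mset :> Type;
  act : mset -> M -> mset;
  act1 : forall x, act x 1%g = x;
  actM : forall x m m', act x (m * m')%g = act (act x m) m' }.

Record state_space (S E : Type) := StateSpace {
  indep : E -> E -> Prop;
  tran : S -> E -> S -> Prop;
  indep_irr : forall a, ~ indep a a;
  indep_sym : forall a b, indep a b -> indep b a;
  tran_det : forall s e s' s'', tran s e s' -> tran s e s'' -> s' = s'';
  tran_diamond : forall a b s s1 v, indep a b -> tran s a s1 -> tran s1 b v ->
    exists2 s2, tran s b s2 & tran s2 a v }.

Section Action.
Variables (S : Type) (E : choiceType) (Sigma : state_space S E).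

(* The pointed set S_* is [option S], with base point [None]. *)
Definition step (x : option S) (e : E) : option S :=
  if x is Some s then
    if pselect (exists s', tran Sigma s e s') is left h then Some (sval (cid h)) else None
  else None.

Lemma stepP s e s' : step (Some s) e = Some s' <-> tran Sigma s e s'.
Proof.
rewrite /step; case: pselect => [h|nh]; last by split=> // h; case: nh; exists s'.
by case: cid => s1 /= t1; split=> [[<-]//|t']; rewrite (tran_det t1 t').
Qed.

Lemma step_swap x a b : indep Sigma a b -> step (step x a) b = step (step x b) a.
Proof.
move=> ab; suff H c d y : indep Sigma c d -> step (step x c) d = Some y ->
    step (step x d) c = Some y.
  case E1 : (step (step x a) b) => [y|]; first by rewrite (H a b y).
  case E2 : (step (step x b) a) => [y|] //.
  by rewrite (H b a y) ?E2 // in E1; exact: indep_sym.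
move=> cd; case: x => // s; case sc: (step (Some s) c) => [s1|//].
move: sc => /stepP sc /stepP s1d.
have [s2 /stepP-> /stepP-> //] := tran_diamond cd sc s1d.
Qed.

Lemma foldl_step_trace u v x :
  trace_eq (indep Sigma) u v -> foldl step x u = foldl step x v.
Proof.
elim=> [w a b w' ab|//|w w' _ -> //|w w' w'' _ -> _ -> //].
by rewrite !foldl_cat /= step_swap.
Qed.

Definition state_act (x : option S) (m : trace (indep Sigma)) : option S :=
  foldl step x (repr m).

Lemma state_actE x u : state_act x (trace_of (indep Sigma) u) = foldl step x u.
Proof. by apply: foldl_step_trace; apply/trace_ofP; rewrite trace_ofK. Qed.

Fact state_act1 x : state_act x 1%g = x.
Proof. by rewrite -trace_of_nil state_actE. Qed.
Fact state_actM x m m' : state_act x (m * m')%g = state_act (state_act x m) m'.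
Proof.
rewrite -(trace_ofK m) -(trace_ofK m') -trace_of_cat !state_actE.
exact: foldl_cat.
Qed.

(* The right M(E, I)-set written U o Sigma. *)
Definition state_mset : right_mset (trace (indep Sigma)) :=
  RightMSet state_act1 state_actM.
End Action.

Section Action_category.
Variables (M : monoidType) (X : right_mset M).

Definition act_hom (x y : X) := {m : M | act x m = y}.

Fact act_hom_eq x y (f g : act_hom x y) : sval f = sval g -> f = g.
Proof. exact: eq_sig_hprop. Qed.

Definition act_idm (x : X) : act_hom x x := exist _ 1%g (act1 x).

Fact act_comp_subproof x y z (f : act_hom x y) (g : act_hom y z) :
  act x (sval f * sval g)%g = z.
Proof. by rewrite actM (svalP f) (svalP g). Qed.
Definition act_comp x y z (f : act_hom x y) (g : act_hom y z) : act_hom x z :=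
  exist _ (sval f * sval g)%g (act_comp_subproof f g).

Fact act_comp_idl x y (f : act_hom x y) : act_comp (act_idm x) f = f.
Proof. by apply: act_hom_eq; exact: mul1g. Qed.
Fact act_comp_idr x y (f : act_hom x y) : act_comp f (act_idm y) = f.
Proof. by apply: act_hom_eq; exact: mulg1. Qed.
Fact act_compA x y z t (f : act_hom x y) (g : act_hom y z) (h : act_hom z t) :
  act_comp f (act_comp g h) = act_comp (act_comp f g) h.
Proof. by apply: act_hom_eq; exact: mulgA. Qed.

Definition act_category : category := Category act_comp_idl act_comp_idr act_compA.
End Action_category.

Definition state_category (S : Type) (E : choiceType) (Sigma : state_space S E) :
  category := act_category (state_mset Sigma).

Definition state_homology (S : Type) (E : choiceType) (Sigma : state_space S E)
    (F : ab_functor (state_category Sigma)) (n : nat) : zmodType :=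
  colim_derived F n.

Definition cube (n : nat) := {ffun 'I_n -> bool}.

(* Coordinates are numbered from 0. *)
Definition delta (n : nat) (i : 'I_n.+1) (e : bool) (t : cube n) : cube n.+1 :=
  [ffun j => if unlift i j is Some k then t k else e].

Inductive box_map : forall m n, (cube m -> cube n) -> Prop :=
| box_map_id n : @box_map n n id
| box_map_delta m n (f : cube m -> cube n) i e :
    box_map f -> box_map (fun t => @delta n i e (f t)).

Record box_hom (m n : nat) := BoxHom {
  box_fun :> cube m -> cube n;
  box_funP : box_map box_fun }.

Lemma box_hom_eq m n (f g : box_hom m n) : f =1 g -> f = g.
Proof.
case: f g => [f hf] [g hg] /= /funext fg; case: _ / fg hg => hg.
by congr BoxHom; exact: Prop_irrelevance.
Qed.

Definition box_id n : box_hom n n := BoxHom (box_map_id n).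

Fact box_comp_subproof m n p (f : box_hom m n) (g : box_hom n p) :
  box_map (fun t => g (f t)).
Proof.
case: f g => [f hf] [g hg] /=.
elim: hg f hf => [k|k l h i e _ IH] f hf; first exact: hf.
by apply: box_map_delta; exact: IH.
Qed.
Definition box_comp m n p (f : box_hom m n) (g : box_hom n p) : box_hom m p :=
  BoxHom (box_comp_subproof f g).

Definition Box : category :=
  @Category nat box_hom box_id box_comp
    (fun m n f => @box_hom_eq m n (box_comp (box_id m) f) f (fun=> erefl))
    (fun m n f => @box_hom_eq m n (box_comp f (box_id n)) f (fun=> erefl))
    (fun m n p q f g h => @box_hom_eq m q (box_comp f (box_comp g h))
       (box_comp (box_comp f g) h) (fun=> erefl)).

Definition face n (i : 'I_n.+1) (e : bool) : @hom Box n n.+1 :=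
  BoxHom (box_map_delta i e (box_map_id n)).

Lemma delta_id n (i : 'I_n.+1) e t : delta i e t i = e.
Proof. by rewrite ffunE unlift_none. Qed.
Lemma delta_lift n (i : 'I_n.+1) e t k : delta i e t (lift i k) = t k.
Proof. by rewrite ffunE liftK. Qed.

Lemma face_face n (i : 'I_n.+1) (j : 'I_n.+2) (k : 'I_n.+1) e e' :
  (i < j)%N -> j = k.+1 :> nat ->
  face i e ;; face j e' = face k e' ;; face (lift j i) e.
Proof.
move=> ij jk; apply: box_hom_eq => t; apply/ffunP => l /=.
have ij' : (j <= i)%N = false by rewrite leqNgt ij.
have [q ->|->] := unliftP j l; last first.
  have jE : lift (lift j i) k = j.
    by apply: val_inj; rewrite /= /bump ij' add0n -ltnS -jk ij jk.
  rewrite delta_id; transitivity (delta (lift j i) e (delta k e' t) (lift (lift j i) k)).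
    by rewrite delta_lift delta_id.
  by rewrite jE.
rewrite delta_lift; have [r ->|->] := unliftP i q; last by rewrite !delta_id.
rewrite delta_lift (_ : lift j (lift i r) = lift (lift j i) (lift k r)).
  by rewrite !delta_lift.
apply: val_inj; rewrite /= /bump ij' add0n.
have kE : k = j.-1 :> nat by rewrite jk.
rewrite kE.
by move: (nat_of_ord i) (nat_of_ord j) (nat_of_ord r) ij {ij' jk kE} => a b c; lia.
Qed.

(* Contravariant functors to sets. *)
Record presheaf (C : category) := Presheaf {
  psh :> C -> Type;
  pmap : forall a b, hom a b -> psh b -> psh a;
  pmap_id : forall a x, pmap (idm a) x = x;
  pmap_comp : forall a b c (f : hom a b) (g : hom b c) x,
    pmap (f ;; g) x = pmap f (pmap g x) }.
Arguments pmap {C} _ {a b} f.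

Section Elements.
Variables (C : category) (X : presheaf C).

Definition elt := {a : C & X a}.
Definition elt_hom (s t : elt) :=
  {f : hom (projT1 s) (projT1 t) | pmap X f (projT2 t) = projT2 s}.

Fact elt_hom_eq s t (f g : elt_hom s t) : sval f = sval g -> f = g.
Proof. exact: eq_sig_hprop. Qed.

Definition elt_idm (s : elt) : elt_hom s s := exist _ (idm _) (pmap_id (projT2 s)).
Fact elt_comp_subproof r s t (f : elt_hom r s) (g : elt_hom s t) :
  pmap X (sval f ;; sval g) (projT2 t) = projT2 r.
Proof. by rewrite pmap_comp (svalP g) (svalP f). Qed.
Definition elt_comp r s t (f : elt_hom r s) (g : elt_hom s t) : elt_hom r t :=
  exist _ (sval f ;; sval g) (elt_comp_subproof f g).

Fact elt_comp_idl s t (f : elt_hom s t) : elt_comp (elt_idm s) f = f.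
Proof. by apply: elt_hom_eq; exact: hcomp_idl. Qed.
Fact elt_comp_idr s t (f : elt_hom s t) : elt_comp f (elt_idm t) = f.
Proof. by apply: elt_hom_eq; exact: hcomp_idr. Qed.
Fact elt_compA r s t q (f : elt_hom r s) (g : elt_hom s t) (h : elt_hom t q) :
  elt_comp f (elt_comp g h) = elt_comp (elt_comp f g) h.
Proof. by apply: elt_hom_eq; exact: hcompA. Qed.

Definition elements : category := Category elt_comp_idl elt_comp_idr elt_compA.
End Elements.

Definition semicubical_set := presheaf Box.

Definition homological_system (X : semicubical_set) :=
  ab_functor (opposite (elements X)).

Section Cubical_homology.
Variables (X : semicubical_set) (G : homological_system X).

Definition cell (n : nat) (s : X n) : elements X := existT _ n s.

Definition restr_hom m n (f : @hom Box m n) (s : X n) :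
    @hom (elements X) (cell (pmap X f s)) (cell s) :=
  exist _ f erefl.

Local Notation coef := (fun s => G (cell s)).
Definition cchain (n : nat) : zmodType := dsum (fun s : X n => G (cell s)).

Section Restriction.
Variables (m n : nat) (f : @hom Box m n).

Definition restr_in (s : X n) (y : G (cell s)) : cchain m :=
  @dsum_in (X m) coef (pmap X f s)
    (@fmap _ G (cell s) (cell (pmap X f s)) (restr_hom f s) y).
Fact restr_in_additive s : zmod_morphism (@restr_in s).
Proof. by move=> x y; rewrite /restr_in !raddfB. Qed.
HB.instance Definition _ s :=
  GRing.isZmodMorphism.Build (G (cell s)) (cchain m) (@restr_in s) (@restr_in_additive s).

(* The map of chain groups that sends the summand of [s] to the summand of
   [X(f)(s)] by the value of [G] at [(f, X(f)(s), s)]. *)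
Definition restr : {additive cchain n -> cchain m} := dsum_lift (fun s => @restr_in s).

Lemma restrE s y : restr (@dsum_in (X n) coef s y) = @restr_in s y.
Proof. exact: dsum_liftE. Qed.

Lemma restr_inE s (y : G (cell s)) s' (h : @hom (elements X) (cell s') (cell s)) :
  sval h = f ->
  @restr_in s y = @dsum_in (X m) coef s' (@fmap _ G (cell s) (cell s') h y).
Proof.
by case: h => /= f' e fE; move: e; rewrite fE => e; case: s' / e.
Qed.
End Restriction.

Lemma restr_comp m n p (f : @hom Box m n) (g : @hom Box n p) x :
  restr (f ;; g) x = restr f (restr g x).
Proof.
apply: (@dsum_ext _ _ _ (restr (f ;; g)) (restr f \o restr g)) => s y.
apply: etrans (restrE _ _) _; apply: esym.
apply: etrans (congr1 (restr f) (restrE _ _)) _.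
apply: etrans (restrE _ _) _; apply: esym.
apply: etrans (@restr_inE _ _ (f ;; g) s y _ (restr_hom f _ ;; restr_hom g s) erefl) _.
rewrite /restr_in; congr dsum_in.
exact: (@fmap_comp _ G (cell s) (cell (pmap X g s)) _ (restr_hom g s) (restr_hom f _) y).
Qed.

(* As coordinates are numbered from 0, the sign of the i-th term of the usual
   formula is that of the exponent [i.+1]. *)
Definition cbd_val (n : nat) (x : cchain n.+1) : cchain n :=
  \sum_(i < n.+1) (restr (face i true) x - restr (face i false) x) *~ (-1) ^+ i.+1.

Fact cbd_additive n : zmod_morphism (@cbd_val n).
Proof.
move=> x y; rewrite /cbd_val -sumrB; apply: eq_bigr => i _.
by rewrite -mulrzBl !(raddfB (restr _)) !opprD !opprK addrACA.
Qed.
HB.instance Definition _ n :=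
  GRing.isZmodMorphism.Build (cchain n.+1) (cchain n) (@cbd_val n) (@cbd_additive n).

Lemma alternating_sum (V : zmodType) n (a : 'I_n.+1 -> 'I_n.+2 -> V) :
  (forall (i : 'I_n.+1) (j : 'I_n.+2) (k : 'I_n.+1), (i < j)%N -> j = k.+1 :> nat ->
     a i j = a k (lift j i)) ->
  \sum_(i < n.+1) \sum_(j < n.+2) a i j *~ (-1) ^+ (i + j) = 0.
Proof.
move=> aE.
have inj (i k : 'I_n.+1) : (i <= k)%N -> lift (lift ord0 k) i = widen_ord (leqnSn _) i.
  by move=> ik; apply: val_inj; rewrite /= /bump; case: leqP => //; rewrite /bump; lia.
transitivity (\sum_(i < n.+1) \sum_(j < n.+2 | (j <= i)%N) a i j *~ (-1) ^+ (i + j)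
   + \sum_(i < n.+1) \sum_(j < n.+2 | ~~ (j <= i)%N) a i j *~ (-1) ^+ (i + j)).
  by rewrite -big_split; apply: eq_bigr => i _; rewrite (bigID (fun j : 'I_n.+2 => (j <= i)%N)).
have -> : \sum_(i < n.+1) \sum_(j < n.+2 | (j <= i)%N) a i j *~ (-1) ^+ (i + j)
  = \sum_(i < n.+1) \sum_(j < n.+1 | (j <= i)%N)
      a i (widen_ord (leqnSn _) j) *~ (-1) ^+ (i + j).
  apply: eq_bigr => i _; rewrite big_mkcond big_ord_recr /=.
  by rewrite [X in if X then _ else _]leqNgt ltn_ord addr0 -big_mkcond.
have -> : \sum_(i < n.+1) \sum_(j < n.+2 | ~~ (j <= i)%N) a i j *~ (-1) ^+ (i + j)
  = \sum_(i < n.+1) \sum_(j < n.+1 | (i <= j)%N)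
      - (a j (widen_ord (leqnSn _) i) *~ (-1) ^+ (j + i)).
  apply: eq_bigr => i _; rewrite big_mkcond big_ord_recl /= add0r -big_mkcond.
  apply: eq_big => [j|j]; rewrite /= /bump add1n -ltnNge ?ltnS // => ij.
  rewrite (aE _ _ j) //= inj // addnS exprS mulN1r mulrNz addnC.
  by [].
rewrite [X in _ + X](exchange_big_dep predT) //= -big_split big1 // => i _.
by rewrite /= -big_split big1 //= => j _; rewrite addrN.
Qed.

Fact cbd_cbd n x : cbd_val (@cbd_val n.+1 x) = 0.
Proof.
pose a (i : 'I_n.+1) (j : 'I_n.+2) :=
  (restr (face i true ;; face j true) x - restr (face i true ;; face j false) x)
  - (restr (face i false ;; face j true) x - restr (face i false ;; face j false) x).
have rE i e : restr (face i e) (cbd_val x) = \sum_(j < n.+2)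
    (restr (face i e ;; face j true) x - restr (face i e ;; face j false) x)
      *~ (-1) ^+ j.+1.
  rewrite /cbd_val raddf_sum; apply: eq_bigr => j _.
  rewrite raddfMz (raddfB (restr _)).
  by rewrite (restr_comp (face i e) (face j true)) (restr_comp (face i e) (face j false)).
rewrite -[RHS](@alternating_sum _ _ a) => [|i j k ij jk].
  rewrite {1}/cbd_val; apply: eq_bigr => i _; rewrite !rE -sumrB.
  rewrite mulrz_suml.
  apply: eq_bigr => j _; rewrite -mulrzBl -mulrzA -exprD.
  by rewrite addnS addSn addnC exprS exprS mulN1r mulN1r opprK.
rewrite /a !(face_face _ _ ij jk) !opprB addrACA [X in _ + X]addrC.
by rewrite addrACA.
Qed.

Definition cubical_complex : chain_complex :=
  @ChainComplex cchain (fun n => @cbd_val n) cbd_cbd.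

Definition cubical_homology (n : nat) : zmodType := homology cubical_complex n.
End Cubical_homology.

Section Free_coordinates.
Variables (m n : nat) (f : box_hom m n).

Fact free_coord_subproof :
  exists c : 'I_m -> 'I_n,
    [/\ forall t j, f t (c j) = t j,
        forall j k : 'I_m, (j < k)%N -> (c j < c k)%N
      & forall i, (exists j, c j = i) \/ exists e, forall t, f t i = e].
Proof.
case: f => g /=; elim=> [k|k l h i e _ [c [cE c_lt cV]]].
  by exists id; split=> // i; left; exists i.
exists (fun j => lift i (c j)); split=> [t j|j j' jk|r].
- by rewrite delta_lift cE.
- by rewrite /= /bump; have := c_lt _ _ jk; lia.
- have [q ->|->] := unliftP i r; last by right; exists e => t; rewrite delta_id.
  have [[j <-]|[e' ek]] := cV q; first by left; exists j.
  by right; exists e' => t; rewrite delta_lift.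
Qed.

(* A morphism of [Box] has the form t |-> u, where each u_i is either a
   constant, or one of the coordinates of t, and these appear in order;
   [free_coord f j] is the place where t_j appears. *)
Definition free_coord : 'I_m -> 'I_n := sval (cid free_coord_subproof).

Lemma free_coordE t j : f t (free_coord j) = t j.
Proof. by rewrite /free_coord; case: cid => c []. Qed.
Lemma free_coord_lt (j k : 'I_m) : (j < k)%N -> (free_coord j < free_coord k)%N.
Proof. by rewrite /free_coord; case: cid => c /= []; move=> _ h _; exact: h. Qed.
Lemma free_coordV i : (exists j, free_coord j = i) \/ exists e, forall t, f t i = e.
Proof. by rewrite /free_coord; case: cid => c []. Qed.

Lemma free_coord_uniq i j : (forall t, f t i = t j) -> free_coord j = i.
Proof.
move=> h; have [[k ki]|[e he]] := free_coordV i.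
  rewrite -{i}ki in h *; apply: contrapT => ne.
  have := h [ffun l => l == j]; rewrite free_coordE !ffunE eqxx => /eqP kj.
  by apply: ne; rewrite kj.
have := h [ffun=> true]; have := h [ffun=> false].
by rewrite !he !ffunE => ->.
Qed.

(* The coordinates that are constantly equal to 1. *)
Definition ones : {pred 'I_n} := fun i => [forall t, f t i].
End Free_coordinates.

Lemma free_coord_id n j : free_coord (box_id n) j = j.
Proof. exact: free_coord_uniq. Qed.

Lemma free_coord_comp m n p (f : box_hom m n) (g : box_hom n p) j :
  free_coord (box_comp f g) j = free_coord g (free_coord f j).
Proof. by apply: free_coord_uniq => t /=; rewrite !free_coordE. Qed.

Lemma free_coord_face n (i : 'I_n.+1) e j : free_coord (face i e) j = lift i j.
Proof. by apply: free_coord_uniq => t /=; rewrite delta_lift. Qed.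

Lemma free_coord_inj m n (f : box_hom m n) : injective (free_coord f).
Proof.
move=> j k; have [jk|kj|/val_inj //] := ltngtP j k => e.
  by have := free_coord_lt f jk; rewrite e ltnn.
by have := free_coord_lt f kj; rewrite e ltnn.
Qed.

Section Word_of_ones.
Variables (E : choiceType) (I : E -> E -> Prop).

(* The product of the [a i] over the coordinates [i] at which [f] is
   constantly 1: this is the element of M(E, I) by which [f] moves the base
   point of a cube. *)
Definition ones_trace m n (f : box_hom m n) (a : 'I_n -> E) : trace I :=
  trace_of I [seq a i | i <- enum 'I_n & ones f i].

Lemma ones_free_coord m n (f : box_hom m n) j : ones f (free_coord f j) = false.
Proof.
by apply/negP => /forallP/(_ [ffun=> false]); rewrite free_coordE ffunE.
Qed.

Lemma ones_id n (a : 'I_n -> E) : ones_trace (box_id n) a = 1%g.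
Proof.
rewrite /ones_trace (eq_filter (a2 := pred0)) ?filter_pred0 // => i.
by apply/negP => /forallP/(_ [ffun=> false]); rewrite ffunE.
Qed.

Lemma ones_comp m n p (f : box_hom m n) (g : box_hom n p) (a : 'I_p -> E) :
  injective a -> (forall i j : 'I_p, (i < j)%N -> I (a i) (a j)) ->
  ones_trace (box_comp f g) a
    = (ones_trace g a * ones_trace f (fun j => a (free_coord g j)))%g.
Proof.
move=> a_inj aI; rewrite /ones_trace -trace_of_cat; apply: trace_of_perm => [x y|].
  move=> /mapP[i _ ->] /mapP[j _ ->] aij.
  have [ij|ji|/val_inj e] := ltngtP i j; [by left; exact: aI|by right; exact: aI|].
  by case: aij; rewrite e.
rewrite (map_comp a (free_coord g) [seq i <- enum 'I_n | ones f i]) -map_cat.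
apply: perm_map; apply: uniq_perm.
- by rewrite filter_uniq ?enum_uniq.
- rewrite cat_uniq filter_uniq ?enum_uniq //= map_inj_uniq; last exact: free_coord_inj.
  rewrite filter_uniq ?enum_uniq // andbT; apply/hasPn => _ /mapP[j _ ->].
  by rewrite /= mem_filter ones_free_coord.
have filterE k (h : pred 'I_k) j : (j \in [seq i <- enum 'I_k | h i]) = h j.
  by rewrite mem_filter mem_enum andbT.
move=> i; rewrite mem_cat !filterE; apply/idP/idP.
  move=> /forallP fg; have [[j ji]|[e ge]] := free_coordV g i.
    apply/orP; right; rewrite -ji; apply: map_f; rewrite filterE.
    by apply/forallP => t; have := fg t; rewrite /= -ji free_coordE.
  apply/orP; left; apply/forallP => t; rewrite ge -(ge (f [ffun=> true])).
  exact: fg.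
case/orP=> [/forallP gi|/mapP[j + ->]]; first by apply/forallP => t; exact: gi.
rewrite filterE => /forallP fj; apply/forallP => t /=.
by rewrite free_coordE; exact: fj.
Qed.

Lemma ones_face n (i : 'I_n.+1) e (a : 'I_n.+1 -> E) :
  ones_trace (face i e) a = if e then trace_of I [:: a i] else 1%g.
Proof.
rewrite /ones_trace; have onesE j : ones (face i e) j = e && (j == i).
  have [k ->|->] := unliftP i j.
    rewrite -{1}(free_coord_face i e) ones_free_coord andbC.
    by rewrite eq_sym (negbTE (neq_lift _ _)).
  rewrite eqxx andbT; apply/forallP/idP => [/(_ [ffun=> false])|eT t];
  by rewrite /= delta_id.
rewrite (eq_filter onesE); case: e {onesE} => /=.
  by rewrite filter_pred1_uniq ?enum_uniq ?mem_enum.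
by rewrite filter_pred0.
Qed.
End Word_of_ones.

Section Qset.
Variables (disp : Order.disp_t) (E : orderType disp) (I : E -> E -> Prop).
Variable X : right_mset (trace I).

Record qcell (n : nat) := QCell {
  qpt : X;
  qev : 'I_n -> E;
  qev_lt : forall i j : 'I_n, (i < j)%N -> (qev i < qev j)%O;
  qev_indep : forall i j : 'I_n, (i < j)%N -> I (qev i) (qev j) }.

Lemma qcell_eq n (s t : qcell n) : qpt s = qpt t -> qev s =1 qev t -> s = t.
Proof.
case: s t => [x a al ai] [y b bl bi] /= -> /funext ab; case: _ / ab bl bi => bl bi.
by congr QCell; exact: Prop_irrelevance.
Qed.

Lemma qev_inj n (s : qcell n) : injective (qev s).
Proof.
move=> i j; have [ij|ji|/val_inj //] := ltngtP i j => e.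
  by have := qev_lt s ij; rewrite e Order.POrderTheory.ltxx.
by have := qev_lt s ji; rewrite e Order.POrderTheory.ltxx.
Qed.

Section Map.
Variables (m n : nat) (f : box_hom m n) (s : qcell n).

Definition qtrace : trace I := ones_trace I f (qev s).

(* The action of an arbitrary morphism of [Box]; see [qmap_face_pt] and
   [qmap_face_ev] for its value at the face maps. *)
Definition qmap : qcell m :=
  @QCell m (act (qpt s) qtrace) (fun j => qev s (free_coord f j))
    (fun i j ij => qev_lt s (free_coord_lt f ij))
    (fun i j ij => qev_indep s (free_coord_lt f ij)).
End Map.

Fact qmap_id n (s : qcell n) : qmap (box_id n) s = s.
Proof.
apply: qcell_eq => [|j] /=; last by rewrite free_coord_id.
by rewrite /qtrace ones_id act1.
Qed.

Lemma qtrace_comp m n p (f : box_hom m n) (g : box_hom n p) (s : qcell p) :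
  qtrace (box_comp f g) s = (qtrace g s * qtrace f (qmap g s))%g.
Proof. exact: ones_comp (@qev_inj _ s) (qev_indep s). Qed.

Fact qmap_comp m n p (f : box_hom m n) (g : box_hom n p) (s : qcell p) :
  qmap (box_comp f g) s = qmap f (qmap g s).
Proof.
apply: qcell_eq => [|j] /=; last by rewrite free_coord_comp.
by rewrite qtrace_comp actM.
Qed.

Definition Qset : semicubical_set :=
  @Presheaf Box qcell (fun m n f s => qmap f s) qmap_id qmap_comp.

Lemma qmap_face_pt n (i : 'I_n.+1) e (s : qcell n.+1) :
  qpt (qmap (face i e) s)
    = act (qpt s) (if e then trace_of I [:: qev s i] else 1%g).
Proof. by rewrite /= /qtrace ones_face. Qed.

Lemma qmap_face_ev n (i : 'I_n.+1) e (s : qcell n.+1) j :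
  qev (qmap (face i e) s) j = qev s (lift i j).
Proof. by rewrite /= free_coord_face. Qed.

Section System.
Variable F : ab_functor (act_category X).

Definition qhom (s t : elements Qset) (f : @hom (elements Qset) s t) :
    @hom (act_category X) (qpt (projT2 t)) (qpt (projT2 s)) :=
  exist _ (qtrace (sval f) (projT2 t)) (congr1 (@qpt _) (svalP f)).

Fact qsys_id (s : opposite (elements Qset)) x :
  fmap F (qhom (@idm (opposite (elements Qset)) s)) x = x.
Proof.
rewrite (_ : qhom _ = idm _) ?fmap_id //.
by apply: act_hom_eq; exact: ones_id.
Qed.

Fact qsys_comp (r s t : opposite (elements Qset)) (f : hom r s) (g : hom s t) x :
  fmap F (qhom (f ;; g)) x = fmap F (qhom g) (fmap F (qhom f) x).
Proof.
rewrite -fmap_comp; congr (fmap F _ x); apply: act_hom_eq.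
case: f g => [f fE] [g gE] /=; rewrite -fE; exact: qtrace_comp.
Qed.

(* The homological system written F with a bar. *)
Definition qsys : homological_system Qset :=
  @AbFunctor (opposite (elements Qset)) (fun s => F (qpt (projT2 s)))
    (fun s t f => fmap F (qhom f)) qsys_id qsys_comp.

Lemma qhom_face n (i : 'I_n.+1) e (s : qcell n.+1) :
  sval (qhom (restr_hom (X := Qset) (face i e) s))
    = if e then trace_of I [:: qev s i] else 1%g.
Proof. exact: ones_face. Qed.
End System.
End Qset.

(* Main.v *)
Require Import Defs.
From mathcomp Require Import all_boot all_order all_algebra.
From HB Require Import structures.
From mathcomp Require Import zify boolp classical_sets cardinality.

(* Both sides are left derived functors of the colimit: the cubical chains
   D(F) form an exact functor of F with H_0 D(F) = colim F, so by dimension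
   shifting along the standard resolution it is enough that D(P) be acyclic in
   positive degrees for P free. For a free functor D(P) is a direct sum of
   copies of the complex of cubes of M(E, I), in which a cube (m; a_1 < ... < a_n)
   is determined by its top vertex v = m a_1 ... a_n and a subset of the
   finite set of right divisors of v in E. Adding the greatest right
   divisor of v is a contracting homotopy up to cubes with a shorter top vertex. *)

Set Implicit Arguments.
Unset Strict Implicit.
Unset Printing Implicit Defensive.

Import Order.TTheory GRing.Theory.
Local Open Scope ring_scope.

(** * Right divisors in the monoid M(E, I) *)

Section Trace_division.
Variables (d : Order.disp_t) (E : orderType d) (I : E -> E -> Prop).
Hypothesis I_irr : forall a, ~ I a a.
Hypothesis I_sym : forall a b, I a b -> I b a.
Implicit Types (a b : E) (u v w : seq E) (x y : trace I).

Lemma trace_eq_perm u v : trace_eq I u v -> perm_eq u v.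
Proof.
elim=> {u v} [u a b v _|u|u v _|u v w _ uv _ vw] //.
- by rewrite perm_cat2l -[a :: _]/([:: a] ++ [:: b] ++ v) perm_catCA.
- by rewrite perm_sym.
- exact: perm_trans uv vw.
Qed.

Definition trace_size x : nat := size (repr x).

Lemma trace_sizeE u : trace_size (trace_of I u) = size u.
Proof. by apply/perm_size/trace_eq_perm/trace_ofP; exact: trace_ofK. Qed.

Lemma trace_sizeM x y : trace_size (x * y)%g = (trace_size x + trace_size y)%N.
Proof.
by rewrite -(trace_ofK x) -(trace_ofK y) -trace_of_cat !trace_sizeE size_cat.
Qed.

Fixpoint del_last a u : seq E :=
  if u is b :: v then
    if a \in v then b :: del_last a v else if b == a then v else b :: v
  else [::].

Lemma del_last_cat a u v :
  del_last a (u ++ v) = if a \in v then u ++ del_last a v else del_last a u ++ v.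
Proof.
elim: u => [|b u IH] /=.
  case: ifPn => // av; elim: v av => //= b v IH; rewrite in_cons negb_or eq_sym.
  by case: eqP => //= _ /[dup] /IH-> /negPf->.
rewrite mem_cat IH; case: (a \in v) => /=; first by rewrite orbT.
by rewrite orbF; case: (a \in u) => //; case: eqP.
Qed.

(** Two swapped letters are distinct because [I] is irreflexive, so at most one of them is the
    deleted [a]. Deletion then either makes the two sides equal or leaves the swap in place. *)
Lemma del_last_trace a u v : trace_eq I u v -> trace_eq I (del_last a u) (del_last a v).
Proof.
elim=> {u v} [u b c v bc|u|u v _|u v w _ uv _ vw]; last exact: trace_trans uv vw.
- rewrite !del_last_cat /= !in_cons.
  have bc' : b != c by apply/eqP => e; apply: (@I_irr c); rewrite -{1}e.
  case: (boolP (a \in v)) => av; first by rewrite !orbT; exact: trace_swap.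
  rewrite !orbF; have [ac|ac] := eqVneq a c; have [ab|ab] := eqVneq a b => /=.
  + by move: bc'; rewrite -ac -ab eqxx.
  + exact: trace_refl.
  + exact: trace_refl.
  + exact: trace_swap.
- exact: trace_refl.
- exact: trace_sym.
Qed.

(** On words, deleting the last [a] undoes right multiplication by [a], and this deletion descends
    to traces. *)
Lemma trace_cancel x y a :
  (x * trace_of I [:: a] = y * trace_of I [:: a])%g -> x = y.
Proof.
rewrite -(trace_ofK x) -(trace_ofK y) -!trace_of_cat => /trace_ofP/(del_last_trace a).
rewrite !del_last_cat !mem_head /= eqxx !cats0 => h.
exact/trace_ofP.
Qed.

Lemma trace_commute a b : I a b ->
  (trace_of I [:: a] * trace_of I [:: b] = trace_of I [:: b] * trace_of I [:: a])%g.
Proof.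
by move=> ab; rewrite -!trace_of_cat; apply/trace_ofP; exact: (@trace_swap _ _ [::] a b [::]).
Qed.

Definition rdiv a x := exists y, x = (y * trace_of I [:: a])%g.

(** Right divisibility read off from a word: some occurrence of [a] is followed only by letters
    independent of [a]. The equivalence is [rdivP]. *)
Fixpoint last_letter a u : Prop :=
  if u is b :: v then last_letter a v \/ b = a /\ forall c, c \in v -> I a c
  else False.

Lemma last_letter_mem a u : last_letter a u -> a \in u.
Proof.
elim: u => //= b u IH [/IH|[-> _]]; last exact: mem_head.
by rewrite in_cons => ->; rewrite orbT.
Qed.

(** Only a swap needs an argument, by induction on the prefix before it. If the occurrence is one of
    the two swapped letters, the other one is independent of it on either side, by symmetry of
    [I]. *)
Lemma last_letter_trace a u v : trace_eq I u v -> last_letter a u <-> last_letter a v.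
Proof.
elim=> {u v} [u b c v bc|//|u v _ [] //|u v w _ [uv vu] _ [vw wv]]; last first.
  by split=> [/uv/vw|/wv/vu].
elim: u => [|e u [IH IH']] /=.
  split=> [[[h|[<- h]]|[<- h]]|[[h|[<- h]]|[<- h]]].
  - by left; left.
  - by right; split=> // e; rewrite in_cons => /predU1P[->|/h //]; exact: I_sym.
  - by left; right; split=> // e ev; apply: h; rewrite in_cons ev orbT.
  - by left; left.
  - by right; split=> // e; rewrite in_cons => /predU1P[->|/h //].
  - by left; right; split=> // e ev; apply: h; rewrite in_cons ev orbT.
have memE f : (f \in u ++ b :: c :: v) = (f \in u ++ c :: b :: v).
  by rewrite !mem_cat !in_cons (orbCA (f == b)).
split=> [[/IH|[-> h]]|[/IH'|[-> h]]]; try by left.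
- by right; split=> // f; rewrite -memE; exact: h.
- by right; split=> // f; rewrite memE; exact: h.
Qed.

Lemma last_letter_split a u : last_letter a u -> rdiv a (trace_of I u).
Proof.
elim: u => //= b u IH [/IH[y uy]|[-> h]].
  by exists (trace_of I [:: b] * y)%g; rewrite -mulgA -uy -trace_of_cat.
exists (trace_of I u); rewrite -[a :: u]cat1s trace_of_cat.
elim: u {IH} h => [|c u IH] h; first by rewrite trace_of_nil mul1g mulg1.
rewrite -[c :: u]cat1s trace_of_cat -mulgA -IH => [|e eu].
  by rewrite !mulgA trace_commute //; apply: h; exact: mem_head.
by apply: h; rewrite in_cons eu orbT.
Qed.

Lemma last_letter_cat a u v :
  last_letter a (u ++ v) -> a \notin v ->
  last_letter a u /\ forall c, c \in v -> I a c.
Proof.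
move=> + av; elim: u => [|b u IH] /=; first by move/last_letter_mem; rewrite (negbTE av).
move=> [/IH[au h]|[-> h]]; first by split=> //; left.
by split=> [|c cv]; [right; split=> // c cu|]; apply: h; rewrite mem_cat ?cu // cv orbT.
Qed.

Lemma last_letter_head a u v :
  (forall c, c \in v -> I a c) -> last_letter a (u ++ a :: v).
Proof. by move=> h; elim: u => [|b u IH]; [right|left]. Qed.

Lemma rdivP a u : rdiv a (trace_of I u) <-> last_letter a u.
Proof.
split=> [[y]|]; last exact: last_letter_split.
rewrite -(trace_ofK y) -trace_of_cat => /trace_ofP/(last_letter_trace a)[_]; apply.
exact: last_letter_head.
Qed.

Lemma rdiv_mul a x v : rdiv a (x * trace_of I v)%g -> a \notin v ->
  rdiv a x /\ forall c, c \in v -> I a c.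
Proof.
rewrite -(trace_ofK x) -trace_of_cat => /rdivP h av.
by have [au vI] := last_letter_cat h av; split=> //; exact/rdivP.
Qed.

Lemma seq_max (s : seq E) a : a \in s -> exists2 b, b \in s & forall c, c \in s -> (c <= b)%O.
Proof.
elim: s a => // b s IH a _; case: s IH => [_|c s IH].
  by exists b; rewrite ?mem_head // => c; rewrite inE => /eqP->.
have [e es eM] := IH c (mem_head _ _).
have [be|eb] := leP b e.
  exists e => [|f]; first by rewrite in_cons es orbT.
  by rewrite in_cons => /predU1P[->//|/eM].
exists b => [|f]; first exact: mem_head.
by rewrite in_cons => /predU1P[->//|/eM/le_trans]; apply; exact: ltW.
Qed.

Definition max_rdiv a x := rdiv a x /\ forall b, rdiv b x -> (b <= a)%O.

Lemma max_rdiv_uniq a b x : max_rdiv a x -> max_rdiv b x -> a = b.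
Proof.
by move=> [ax ha] [bx hb]; apply: le_anti; rewrite ha ?hb.
Qed.

(** The right divisors of a trace occur in each word that represents it, so they are finite in
    number; the final letter of a nonempty word is one of them. *)
Lemma max_rdiv_exists x : x <> 1%g -> exists a, max_rdiv a x.
Proof.
rewrite -(trace_ofK x); move: (repr x) => u u1.
have [a au] : exists a, last_letter a u.
  case: u u1 => // b u _; elim: u b => [|c u IH] b; first by exists b; right.
  by have [a au] := IH c; exists a; left.
pose s := [seq b <- u | `[< last_letter b u >]].
have sE b : b \in s <-> last_letter b u.
  rewrite mem_filter; split=> [/andP[/asboolP]//|bu].
  by rewrite last_letter_mem // andbT; exact/asboolP.
have [b /sE bu bM] := seq_max (proj2 (sE a) au).
by exists b; split=> [|c /rdivP cu]; [exact/rdivP|exact/bM/sE].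
Qed.
End Trace_division.

Lemma dsum_ind (T : Type) (G : T -> zmodType) (P : dsum G -> Prop) :
  (forall x y, P x -> P y -> P (x - y)) -> (forall t (y : G t), P (@dsum_in T G t y)) ->
  P 0 -> forall x, P x.
Proof.
move=> PB Pin P0 x; rewrite (dsum_decomp x); apply: big_ind => // y z Py Pz.
by rewrite -[z]opprK -[- z]sub0r; apply: (PB) => //; exact: (PB).
Qed.

(** * Cubes of M(E, I) and their extension by the greatest right divisor *)

Section Acyclicity.
Variables (d : Order.disp_t) (E : orderType d) (I : E -> E -> Prop).
Hypothesis I_irr : forall a, ~ I a a.
Hypothesis I_sym : forall a b, I a b -> I b a.

Definition regular_mset : right_mset (trace I) :=
  @RightMSet _ (trace I) (fun x y => (x * y)%g) (@mulg1 _) (@mulgA _).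

Section Extension.
Local Notation qcell := (qcell regular_mset).
Local Notation face_map i e s := (qmap (face i e) s : qcell _).

(** The vertex opposite to the base point [qpt s]. *)
Definition qtop n (s : qcell n) : trace I :=
  (qpt s * trace_of I [seq qev s i | i <- enum 'I_n])%g.

(** An upper face moves one letter from the events to the base point, and the events of a cube
    commute. Hence a cube and its upper faces share the greatest right divisor of the top vertex. *)
Lemma qtop_face n (i : 'I_n.+1) (s : qcell n.+1) : qtop (face_map i true s) = qtop s.
Proof.
rewrite /qtop qmap_face_pt /= -mulgA -trace_of_cat; congr (_ * _)%g.
rewrite (eq_map (fun j => qmap_face_ev i true s j)) /=.
rewrite (map_comp (qev s) (lift i)) -[_ :: _]/(map (qev s) (i :: map (lift i) (enum 'I_n))).
apply: trace_of_perm => [a b|].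
  move=> /mapP[j _ ->] /mapP[k _ ->] ne; have [jk|kj|/val_inj e] := ltngtP j k.
  - by left; exact: qev_indep.
  - by right; exact: qev_indep.
  - by case: ne; rewrite e.
apply: perm_map; apply: uniq_perm; rewrite ?enum_uniq //=.
  rewrite map_inj_uniq ?enum_uniq ?andbT; last exact: lift_inj.
  by apply/mapP => -[j _ /eqP]; rewrite (negbTE (neq_lift _ _)).
move=> j; rewrite mem_enum in_cons; have [k ->|->] := unliftP i j; last by rewrite eqxx.
by rewrite map_f ?orbT // mem_enum.
Qed.

(* The cube [s'] is obtained from [s] by adding the direction of the greatest
   letter by which the top vertex of [s] is divisible; [s] is its last upper
   face. *)
Definition extends n (s : qcell n) (s' : qcell n.+1) :=
  [/\ qpt s = (qpt s' * trace_of I [:: qev s' ord_max])%g,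
      forall j, qev s j = qev s' (lift ord_max j)
    & max_rdiv (qev s' ord_max) (qtop s)].

(** The greatest divisor is unique, which fixes the new direction; right cancellation then fixes the
    base point. *)
Lemma extends_uniq n (s : qcell n) s1 s2 : extends s s1 -> extends s s2 -> s1 = s2.
Proof.
move=> [p1 e1 m1] [p2 e2 m2]; have maxE := max_rdiv_uniq m1 m2.
apply: qcell_eq => [|j].
  by apply: (trace_cancel I_irr (a := qev s1 ord_max)); rewrite -p1 p2 maxE.
by have [k ->|->//] := unliftP ord_max j; rewrite -e1 e2.
Qed.

Lemma extends_last_face n (s : qcell n) s' : extends s s' -> face_map ord_max true s' = s.
Proof.
by move=> [p e _]; apply: qcell_eq => [|j]; rewrite ?qmap_face_pt ?qmap_face_ev ?p ?e.
Qed.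

(** Upper faces keep the top vertex, so extension commutes with them. The new direction comes last,
    so the index [i] means the same direction in [s] and in [s']. *)
Lemma extends_face n (s : qcell n.+1) s' (i : 'I_n.+1) : extends s s' ->
  extends (face_map i true s) (face_map (widen_ord (leqnSn _) i) true s').
Proof.
move=> [p e m].
have maxE : lift (widen_ord (leqnSn _) i) ord_max = ord_max :> 'I_n.+2.
  by apply: val_inj; rewrite /= /bump -ltnS ltn_ord.
have wE : qev s i = qev s' (widen_ord (leqnSn _) i).
  by rewrite e; congr (qev s' _); apply: val_inj; rewrite /= /bump leqNgt ltn_ord.
split=> [|j|].
- rewrite !qmap_face_pt !qmap_face_ev maxE /= p wE -!mulgA; congr (_ * _)%g.
  by apply: trace_commute; apply: I_sym; apply: qev_indep; rewrite /= ltn_ord.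
- rewrite !qmap_face_ev e; congr (qev s' _); apply: val_inj; rewrite /= /bump.
  by have := ltn_ord i; have := ltn_ord j; lia.
- by rewrite qtop_face qmap_face_ev maxE.
Qed.

(** The events commute, so the [i]-th one can be moved to the end of the product. *)
Lemma qev_rdiv n (s : qcell n) i : rdiv (qev s i) (qtop s).
Proof.
case: n s i => [s []//|n s i]; rewrite -(qtop_face i s).
pose t := face_map i true s; exists (qpt s * trace_of I [seq qev t j | j <- enum 'I_n])%g.
rewrite /qtop qmap_face_pt -!mulgA; congr (_ * _)%g; rewrite -/t -!trace_of_cat.
apply: trace_of_perm; last by rewrite perm_catC.
move=> a b; have mE c :
    c \in [:: qev s i] ++ [seq qev t j | j <- enum 'I_n] -> exists k, c = qev s k.
  rewrite in_cons => /predU1P[->|/mapP[j _ ->]]; first by exists i.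
  by rewrite qmap_face_ev; eexists.
move=> /mE[j ->] /mE[k ->] ne; have [jk|kj|/val_inj e] := ltngtP j k.
- by left; exact: qev_indep.
- by right; exact: qev_indep.
- by case: ne; rewrite e.
Qed.

(** Let [a] be the greatest right divisor of the top vertex. If [a] is an event of [s], it is the
    last one, since every event divides the top. Otherwise [a] is independent of all events, exceeds
    them, and divides the base point, so it can be added as a last direction. *)
Lemma extends_or_last n (s : qcell n.+1) :
  (exists s', extends s s') \/ max_rdiv (qev s ord_max) (qtop s).
Proof.
(* The top vertex is not 1, its length being at least [n.+1]. *)
have [e|a am] := max_rdiv_exists I_sym (x := qtop s).
  have := trace_sizeE I [::]; rewrite trace_of_nil -e trace_sizeM trace_sizeE size_map.
  by rewrite size_enum_ord addnS.
have [as_|as_] := boolP (a \in [seq qev s i | i <- enum 'I_n.+1]).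
  right; case/mapP: as_ => i _ ai; rewrite -[ord_max](_ : i = _) -?ai //.
  apply: val_inj => /=; apply/eqP; rewrite eqn_leq -ltnS ltn_ord /= leqNgt; apply/negP => im.
  have := @qev_lt _ _ _ _ _ s i ord_max im; rewrite ltNge -ai.
  by have [_ ->] := am; last exact: qev_rdiv.
have [[y yE] aI] := rdiv_mul I_sym am.1 as_.
have lt_a i : (qev s i < a)%O.
  rewrite lt_neqAle am.2 ?andbT; last exact: qev_rdiv.
  by apply: contraNneq as_ => <-; rewrite map_f ?mem_enum.
have ind_a i : I (qev s i) a by apply/I_sym/aI; rewrite map_f ?mem_enum.
pose ev (i : 'I_n.+2) := if unlift ord_max i is Some j then qev s j else a.
have ev_lift j : ev (lift ord_max j) = qev s j by rewrite /ev liftK.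
have ev_max : ev ord_max = a by rewrite /ev unlift_none.
(* One argument serves both conditions on events, with [R] the strict order or [I]. *)
have evP (R : E -> E -> Prop) : (forall i j : 'I_n.+1, (i < j)%N -> R (qev s i) (qev s j)) ->
    (forall i, R (qev s i) a) -> forall i j : 'I_n.+2, (i < j)%N -> R (ev i) (ev j).
  move=> h h' i j.
  have [i' ->|->] := unliftP ord_max i; last by rewrite ltnNge -ltnS ltn_ord.
  have [j' ->|-> _] := unliftP ord_max j; last by rewrite ev_lift ev_max.
  by rewrite !lift_max !ev_lift => /h.
left; exists (@QCell _ _ _ regular_mset _ y ev
  (evP (fun a b => (a < b)%O) (@qev_lt _ _ _ _ _ s) lt_a)
  (evP I (@qev_indep _ _ _ _ _ s) ind_a)).
by split=> [|j|] /=; rewrite ?ev_max ?ev_lift.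
Qed.

(** With [extends_or_last], this pairs each cube of positive dimension either with a cube one
    dimension higher or with its own last upper face. *)
Lemma max_extends_last_face n (s : qcell n.+1) :
  max_rdiv (qev s ord_max) (qtop s) -> extends (face_map ord_max true s) s.
Proof.
by move=> m; split=> [|j|]; rewrite ?qmap_face_pt ?qmap_face_ev ?qtop_face.
Qed.

(** Such a face still has the greatest divisor among its events, so an extension would contain that
    letter twice. *)
Lemma max_not_extends n (s : qcell n.+1) (i : 'I_n.+1) s' : i != ord_max ->
  max_rdiv (qev s ord_max) (qtop s) -> ~ extends (face_map i true s) s'.
Proof.
move=> ne m [_ e m']; rewrite qtop_face in m'.
have [j jE|/esym/eqP] := unliftP i ord_max; last by rewrite (negbTE ne).
have := e j; rewrite qmap_face_ev -jE (max_rdiv_uniq m m') => /qev_inj/eqP.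
by rewrite (negbTE (neq_lift _ _)).
Qed.

Lemma max_not_extends_self n (s : qcell n.+1) s' :
  max_rdiv (qev s ord_max) (qtop s) -> ~ extends s s'.
Proof.
move=> m [_ e m']; have := e ord_max; rewrite (max_rdiv_uniq m m') => /qev_inj/eqP.
by rewrite (negbTE (neq_lift _ _)).
Qed.
End Extension.

(** * The contracting homotopy for free coefficients *)

Section Homotopy.
Variables (X : right_mset (trace I)) (K : ab_functor (act_category X)).
Local Notation P := (free_functor K).
Local Notation D q := (cchain (qsys P) q).

(* The image of the cube [s] under the map of [M(E, I)] to [X] that sends 1 to
   [c]. *)
Definition orbit_cell (c : X) q (s : qcell regular_mset q) : qcell X q :=
  @QCell _ _ _ X q (act c (qpt s)) (qev s) (@qev_lt _ _ _ _ _ s) (@qev_indep _ _ _ _ _ s).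

(** A cube of [X] with a generator (c, k, m) of the free coefficient group at its base point amounts
    to a cube of M(E, I) based at m, together with c and k. This splits the chains of [P] into
    copies of the complex of M(E, I). *)
Definition basis (c : X) (k : K c) q (s : qcell regular_mset q) : D q :=
  @dsum_in (qcell X q) (fun s => P (qpt s)) (orbit_cell c s)
    (@free_in (act_category X) K _
      (existT _ c (k, exist (fun m => act c m = act c (qpt s)) (qpt s) erefl)) 1).

Lemma restr_basis (c : X) (k : K c) m n (f : box_hom m n) s :
  restr (qsys P) f (basis k s) = basis k (qmap f s).
Proof.
apply: etrans (restrE _ _) _.
have e : qmap f (orbit_cell c s) = orbit_cell c (qmap f s).
  by apply: qcell_eq => //=; rewrite actM.
(* The two cells agree only by the proof [e]; passing to the morphism [h], which starts at the
   desired cell, changes the summand accordingly. *)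
pose h : @Defs.hom (elements (Qset X)) (cell (X := Qset X) (orbit_cell c (qmap f s)))
  (cell (X := Qset X) (orbit_cell c s)) := exist _ f e.
apply: etrans (restr_inE (G := qsys P) _ (h := h) erefl) _.
congr dsum_in; apply: etrans (free_mapE _ _ _) _.
apply: (congr1 (fun u : act_hom c (act c (qpt (qmap f s))) =>
  @free_in (act_category X) K _ (existT _ c (k, u)) 1)).
exact: act_hom_eq.
Qed.

Definition fill_basis (c : X) (k : K c) q (s : qcell regular_mset q) : D q.+1 :=
  if pselect (exists s', extends s s') is left h then basis k (sval (cid h)) else 0.

Lemma fill_extends (c : X) (k : K c) q (s : qcell regular_mset q) s' :
  extends s s' -> fill_basis k s = basis k s'.
Proof.
rewrite /fill_basis => e; case: pselect => [h|[]]; last by exists s'.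
by case: cid => s2 e2; rewrite (extends_uniq e e2).
Qed.

Lemma fill_not_extends (c : X) (k : K c) q (s : qcell regular_mset q) :
  (forall s', ~ extends s s') -> fill_basis k s = 0.
Proof. by rewrite /fill_basis => n; case: pselect => // h; case: (n _ (svalP (cid h))). Qed.

Definition fill q : {additive D q -> D q.+1} :=
  dsum_lift (fun s : qcell X q => dsum_lift (fun t : free_gen K (qpt s) =>
    multiples (fill_basis (projT2 t).1 (@QCell _ _ _ regular_mset q (sval (projT2 t).2)
      (qev s) (@qev_lt _ _ _ _ _ s) (@qev_indep _ _ _ _ _ s))))).

Lemma fillE (c : X) (k : K c) q (s : qcell regular_mset q) :
  fill q (basis k s) = fill_basis k s.
Proof.
apply: etrans (dsum_liftE _ _) _; apply: etrans (dsum_liftE _ _) _.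
by apply: etrans (mulr1z _) _; case: s.
Qed.

(* Spanned by the cubes whose top vertex has length less than [N]. *)
Inductive fil (N q : nat) : D q -> Prop :=
| fil_basis (c : X) (k : K c) (s : qcell regular_mset q) :
    (trace_size (qpt s) + q < N)%N -> fil N (basis k s)
| fil0 : fil N 0
| filB x y : fil N x -> fil N y -> fil N (x - y).

Lemma filN N q (x : D q) : fil N x -> fil N (- x).
Proof. by move=> xN; rewrite -sub0r; apply: filB => //; exact: fil0. Qed.

Lemma filD N q (x y : D q) : fil N x -> fil N y -> fil N (x + y).
Proof. by move=> xN /filN yN; rewrite -[y]opprK; exact: filB. Qed.

Lemma fil_sign N q (x : D q) n : fil N x -> fil N (x *~ (-1) ^+ n).
Proof. by move=> xN; rewrite -signr_odd; case: odd; rewrite ?mulrN1z ?mulr1z //; exact: filN. Qed.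

Lemma fil_sum N q n (x : 'I_n -> D q) : (forall i, fil N (x i)) -> fil N (\sum_i x i).
Proof. by move=> xN; apply: big_ind => [|y z|i _] //; [exact: fil0|exact: filD]. Qed.

Lemma fil_widen N N' q (x : D q) : (N <= N')%N -> fil N x -> fil N' x.
Proof.
move=> le; elim=> [c k s lt|| y z _ IHy _ IHz]; [|exact: fil0|exact: filB].
by apply: fil_basis; exact: leq_trans le.
Qed.

(** A chain is a finite integral combination of elements [basis k s]. *)
Lemma fil_exists q (x : D q) : exists N, fil N x.
Proof.
have B y z : (exists N, fil N y) -> (exists N, @fil N q z) -> exists N, @fil N q (y - z).
  move=> [N yN] [N' zN']; exists (maxn N N').
  by apply: filB; [apply: fil_widen yN; exact: leq_maxl|apply: fil_widen zN'; exact: leq_maxr].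
have Z : exists N, @fil N q 0 by exists 0%N; exact: fil0.
apply: (dsum_ind (P := fun x : D q => exists N, fil N x)) => // s.
apply: (dsum_ind (P := fun y => exists N, @fil N q (dsum_in y))) => [y z yN zN|t k|].
- by rewrite raddfB; exact: B.
- suff [N tN] : exists N, @fil N q (@dsum_in (qcell X q) (fun s => P (qpt s)) s (free_in t 1)).
    exists N; rewrite -[k]intz; elim/int_rect: k => [|n IH|n IH].
    + by rewrite !raddf0; exact: fil0.
    + by rewrite -addn1 PoszD !raddfD; exact: filD.
    + by rewrite -addn1 PoszD opprD !raddfB; exact: filB.
  case: s t => z ev lt ind [c [k' [m /= e]]]; case: z / e.
  exists (trace_size m + q).+1.
  exact: (@fil_basis _ _ c k' (@QCell _ _ _ regular_mset q m ev lt ind)).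
- by rewrite raddf0.
Qed.

(** The sign is that of the last upper face of a cube of dimension [q.+1], so that this face of a
    filling enters its boundary with coefficient 1. *)
Local Notation fill_sign q x := (fill q x *~ (-1) ^+ q.+1).

Lemma cbd_basis (c : X) (k : K c) q (s : qcell regular_mset q.+1) :
  cbd_val (basis k s) = \sum_(i < q.+1)
    (basis k (qmap (face i true) s) - basis k (qmap (face i false) s)) *~ (-1) ^+ i.+1.
Proof. by apply: eq_bigr => i _; rewrite !restr_basis. Qed.

(** Filling keeps the length of the top vertex: the base point loses one letter and the dimension
    grows by one. *)
Lemma fil_fill (c : X) (k : K c) q (s : qcell regular_mset q) N :
  (trace_size (qpt s) + q < N)%N -> fil N (fill_basis k s).
Proof.
rewrite /fill_basis => sN; case: pselect => [h|_]; last exact: fil0.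
have [p _ _] := svalP (cid h); apply: fil_basis; move: sN.
by rewrite p trace_sizeM trace_sizeE /=; lia.
Qed.

(** A lower face keeps the base point and loses a dimension, so its top vertex is one letter
    shorter: lower faces drop in the filtration. *)
Lemma trace_size_lower_face q (i : 'I_q.+1) (s : qcell regular_mset q.+1) :
  trace_size (qpt (qmap (face i false) s)) = trace_size (qpt s).
Proof. by rewrite qmap_face_pt /= mulg1. Qed.

(** Modulo cubes with a shorter top vertex only upper faces count. They are treated by the two cases
    of [extends_or_last]. *)
Lemma fill_homotopy_basis (c : X) (k : K c) q (s : qcell regular_mset q.+1) N :
  (trace_size (qpt s) + q.+1 < N.+1)%N ->
  fil N (cbd_val (fill_sign q.+1 (basis k s)) + fill_sign q (cbd_val (basis k s)) - basis k s).
Proof.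
move=> sN; set sg : int := (-1) ^+ q.+1.
have sg2 (V : zmodType) (v : V) : v *~ sg *~ sg = v.
  by rewrite -mulrzA -exprD addnn -signr_odd odd_double mulr1z.
have fill_face (i : 'I_q.+1) : fil N (fill_basis k (qmap (face i false) s)).
  by apply: fil_fill; rewrite trace_size_lower_face; lia.
have bdN (x : D q.+2) : cbd_val (x *~ (-1) ^+ q.+2) = - (cbd_val x *~ sg).
  by rewrite (raddfMz (@cbd_val _ (qsys P) q.+1)) exprS mulN1r mulrNz.
rewrite bdN fillE.
have -> : fill q (cbd_val (basis k s)) =
    \sum_(i < q.+1) fill_basis k (qmap (face i true) s) *~ (-1) ^+ i.+1
    - \sum_(i < q.+1) fill_basis k (qmap (face i false) s) *~ (-1) ^+ i.+1.
  rewrite cbd_basis raddf_sum -sumrB; apply: eq_bigr => i _.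
  by rewrite raddfMz raddfB !fillE mulrzBl.
have [[s' ss']|smax] := extends_or_last s.
  rewrite (fill_extends k ss') cbd_basis big_ord_recr (extends_last_face ss').
  have -> : \sum_(i < q.+1) fill_basis k (qmap (face i true) s) *~ (-1) ^+ i.+1
    = \sum_(i < q.+1) basis k (qmap (face (widen_ord (leqnSn _) i) true) s') *~ (-1) ^+ i.+1.
    by apply: eq_bigr => i _; rewrite (fill_extends k (extends_face i ss')).
  under eq_bigr do rewrite mulrzBl.
  rewrite sumrB.
  set A := \sum_(i < q.+1) _ *~ _; set B' := \sum_(i < q.+1) _ *~ _.
  set B := \sum_(i < q.+1) _ *~ _; set e := basis k s; set f := basis k _.
  (* The upper faces of [s'] other than the last are the fillings of those of [s] and cancel; the
     last one is [s] and cancels [e]. There remain the lower faces of [s'] and the fillings of the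
     lower faces of [s]. *)
  rewrite (_ : _ - e = B *~ sg - f - B' *~ sg).
    apply: filB; last by apply: fil_sign; apply: fil_sum => i; exact: fil_sign (fill_face i).
    have [p _ _] := ss'.
    have sN' i : (trace_size (qpt (qmap (face i false) s')) + q.+1 < N)%N.
      by rewrite trace_size_lower_face; move: sN; rewrite p trace_sizeM trace_sizeE /=; lia.
    apply: filB; last exact: fil_basis (sN' _).
    by apply: fil_sign; apply: fil_sum => i; apply: fil_sign; exact: fil_basis (sN' _).
  rewrite /= exprS mulN1r mulrNz -/sg !mulrzBl !sg2.
  move: (A *~ sg) (B *~ sg) (B' *~ sg) => a b b'.
  rewrite !opprB -addrA addrACA addrC addrA [X in X + _]addrA subrK.
  by rewrite [b - a - f]addrAC addrA subrK.
(* Here [s] has filling 0, and among its upper faces only the last one has a filling, namely [s]. *)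
rewrite fill_not_extends => [|s' ss']; last exact: max_not_extends_self smax ss'.
rewrite raddf0 mul0rz oppr0 add0r (bigD1 ord_max) //= -/sg.
rewrite (fill_extends k (max_extends_last_face smax)) [X in _ + X - _]big1 => [|i ne]; last first.
  by rewrite fill_not_extends ?mul0rz // => s'; exact: max_not_extends.
rewrite addr0 mulrzBl sg2 addrAC subrr add0r.
by apply/filN/fil_sign/fil_sum => i; exact: fil_sign (fill_face i).
Qed.

Lemma fill_homotopy q (x : D q.+1) N : fil N.+1 x ->
  fil N (cbd_val (fill_sign q.+1 x) + fill_sign q (cbd_val x) - x).
Proof.
elim=> [c k s|| y z _ IHy _ IHz]; first exact: fill_homotopy_basis.
  by rewrite subr0 !raddf0 !mul0rz raddf0 addr0; exact: fil0.
rewrite !raddfB !mulrzBl raddfB.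
have := filB IHy IHz; congr fil.
by rewrite opprD addrACA -opprD; congr (_ - _); rewrite opprD addrACA.
Qed.

(** For a cycle, the homotopy formula exhibits it as a boundary up to a cycle one step lower in the
    filtration. The descent ends at [fil 0], which contains only 0. *)
Lemma free_acyclic q (x : D q.+1) : cbd_val x = 0 -> exists y, @cbd_val _ (qsys P) q.+1 y = x.
Proof.
have [N xN] := fil_exists x; elim: N x xN => [|N IH] x xN dx.
  by exists 0; rewrite raddf0; elim: xN => // y z _ <- _ <-; rewrite subr0.
have := fill_homotopy xN; rewrite dx raddf0 mul0rz addr0 => /IH[|y yx].
  by rewrite (raddfB (@cbd_val _ (qsys P) q)) /= dx subr0 cbd_cbd.
exists (fill_sign q.+1 x - y).
by rewrite (raddfB (@cbd_val _ (qsys P) q.+1)) /= yx opprB addrC subrK.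
Qed.
End Homotopy.
End Acyclicity.

(** * Isomorphisms of homology groups induced by additive relations *)

Lemma zmod_iso_trans (A B C : zmodType) : zmod_iso A B -> zmod_iso B C -> zmod_iso A C.
Proof. by move=> [f fb] [g gb]; exists (g \o f); exact: bij_comp. Qed.

Lemma zmod_iso_sym (A B : zmodType) : zmod_iso A B -> zmod_iso B A.
Proof.
move=> [f [g fK gK]]; have gB : zmod_morphism g.
  by move=> x y; apply: (can_inj fK); rewrite raddfB !gK.
by exists (HB.pack_for {additive B -> A} g (GRing.isZmodMorphism.Build _ _ g gB)); exists f.
Qed.

Lemma coker_iso (A B C : zmodType) (f : {additive A -> B}) (g : {additive B -> C}) :
  (forall z, exists y, g y = z) -> (forall y, g y = 0 <-> exists x, f x = y) ->
  zmod_iso (coker f) C.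
Proof.
move=> surj ex; have gf0 x : g (f x) = 0 by apply/ex; exists x.
exists (coker_lift gf0).
exists (fun z => coker_pi f (sval (cid (surj z)))) => [w|z].
  have [y <-] := coker_pi_surj w; case: cid => y' /= e.
  have {e} /eqP := etrans e (coker_liftE gf0 y); rewrite -subr_eq0 -raddfB => /eqP/ex/coker_pi_eq0.
  by rewrite raddfB => /eqP; rewrite subr_eq0 => /eqP.
by apply: etrans (coker_liftE gf0 _) _; case: cid.
Qed.

(** Relations allow diagram chases without additive choices of preimages. Two partners of one
    element differ by a partner of 0, which lies in the image of [g], so a map of cokernels is well
    defined. *)
Lemma coker_rel_iso (A' A B' B : zmodType) (f : {additive A' -> A}) (g : {additive B' -> B})
    (R : A -> B -> Prop) :
  (forall a b a' b', R a b -> R a' b' -> R (a - a') (b - b')) ->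
  (forall a, exists b, R a b) -> (forall b, exists a, R a b) ->
  (forall a b, R a b -> (exists x, f x = a) <-> exists y, g y = b) ->
  zmod_iso (coker f) (coker g).
Proof.
move=> RB totl totr im; pose h a : coker g := coker_pi g (sval (cid (totl a))).
have hE a b : R a b -> h a = coker_pi g b.
  rewrite /h; case: cid => b' /= ab' ab; apply/eqP; rewrite -subr_eq0 -raddfB; apply/eqP.
  have := RB _ _ _ _ ab' ab; rewrite subrr => /im[+ _].
  by move=> /(_ (ex_intro _ 0 (raddf0 f)))/coker_pi_eq0.
have hR a : exists2 b, R a b & h a = coker_pi g b.
  by have [b ab] := totl a; exists b => //; exact: hE.
have hB : zmod_morphism h.
  move=> a a'; have [[b ab ->] [b' ab' ->]] := (hR a, hR a').
  by rewrite -raddfB; apply: hE; exact: RB.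
apply: (@coker_iso _ _ _ f
  (HB.pack_for {additive A -> coker g} h (GRing.isZmodMorphism.Build _ _ h hB))) => [z|a] /=.
  by have [b <-] := coker_pi_surj z; have [a /hE] := totr b; exists a.
by have [b ab ->] := hR a; rewrite (im _ _ ab); exact: coker_pi_eq0.
Qed.

Lemma homology_rel_iso (C C' : chain_complex) m n (R : C m.+1 -> C' n.+1 -> Prop) :
  (forall a b a' b', R a b -> R a' b' -> R (a - a') (b - b')) ->
  (forall a, bd C m a = 0 -> exists2 b, bd C' n b = 0 & R a b) ->
  (forall b, bd C' n b = 0 -> exists2 a, bd C m a = 0 & R a b) ->
  (forall a b, R a b -> (exists x, bd C m.+1 x = a) <-> exists y, bd C' n.+1 y = b) ->
  zmod_iso (homology C m.+1) (homology C' n.+1).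
Proof.
move=> RB totl totr im.
apply: (@coker_rel_iso _ _ _ _ (bd_cycles C m.+1) (bd_cycles C' n.+1)
  (fun a b => R (ker_val a) (ker_val b))) => [a b a' b'|a|b|a b /im[ab ba]] /=.
- exact: RB.
- have [b /eqP b0 ab] := totl _ (ker_valE a).
  by exists (@Ker _ _ (bd C' n) b b0).
- have [a /eqP a0 ab] := totr _ (ker_valE b).
  by exists (@Ker _ _ (bd C m) a a0).
- split=> -[x xE].
    have [|y yE] := ab; first by exists x; rewrite -xE.
    by exists y; apply: val_inj.
  have [|y yE] := ba; first by exists x; rewrite -xE.
  by exists y; apply: val_inj.
Qed.

(** * Cubical chains as an exact functor of the coefficients, and their augmentation *)

Section Direct_sum_map.
Variables (T : Type) (G H : T -> zmodType) (u : forall t, {additive G t -> H t}).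

Fact dsum_map_subproof (x : dsum G) : finite_set (fun t => u t (x t) <> 0).
Proof.
apply: (sub_finite_set _ (dsum_finite x)) => t /= ux xt; apply: ux.
by rewrite xt raddf0.
Qed.
Definition dsum_map (x : dsum G) : dsum H := DSum (dsum_map_subproof x).

Fact dsum_map_additive : zmod_morphism dsum_map.
Proof. by move=> x y; apply: dsum_eqP => t; exact: raddfB. Qed.
HB.instance Definition _ :=
  GRing.isZmodMorphism.Build (dsum G) (dsum H) dsum_map dsum_map_additive.

Lemma dsum_map_in t (x : G t) : dsum_map (@dsum_in T G t x) = @dsum_in T H t (u t x).
Proof.
apply: dsum_eqP => t' /=; have [<-|ne] := pselect (t = t').
  by rewrite !single_valE.
by rewrite !single_valN // raddf0.
Qed.

Lemma dsum_map_lift (x : dsum H) :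
  (forall t, exists y, u t y = x t) -> exists y, dsum_map y = x.
Proof.
(* Choosing the preimage 0 wherever [x] vanishes keeps the support finite. *)
move=> h; pose y t : G t := if x t == 0 then 0 else sval (cid (h t)).
have y_fin : finite_set (fun t => y t <> 0).
  apply: (sub_finite_set _ (dsum_finite x)) => t /= yt xt; apply: yt.
  by rewrite /y; case: eqP.
exists (DSum y_fin); apply: dsum_eqP => t /=; rewrite /y.
by case: eqP => [->|_]; [rewrite raddf0|case: cid].
Qed.
End Direct_sum_map.

Section Cubical_chains.
Variables (d : Order.disp_t) (E : orderType d) (I : E -> E -> Prop).
Hypothesis I_irr : forall a, ~ I a a.
Hypothesis I_sym : forall a b, I a b -> I b a.
Variable X : right_mset (trace I).
Local Notation functor := (ab_functor (act_category X)).
Local Notation D F q := (cchain (qsys F) q).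

Definition bdry (F : functor) q : {additive D F q.+1 -> D F q} := @cbd_val _ (qsys F) q.

Lemma bdry_bdry (F : functor) q x : bdry F q (bdry F q.+1 x) = 0.
Proof. exact: cbd_cbd. Qed.

Section Map.
Variables (F G : functor) (u : ab_nat F G).

Definition cmap q : {additive D F q -> D G q} :=
  dsum_map (fun s : qcell X q => u (qpt s)).

Lemma cmap_restr m n (f : box_hom m n) (x : D F n) :
  cmap m (restr (qsys F) f x) = restr (qsys G) f (cmap n x).
Proof.
apply: (@dsum_ext _ _ _ (cmap m \o restr (qsys F) f) (restr (qsys G) f \o cmap n)) => s y.
apply: etrans (congr1 (cmap m) (restrE _ _)) _; apply: etrans (dsum_map_in _ _) _.
apply: esym; apply: etrans (congr1 (restr _ f) (dsum_map_in _ _)) _.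
apply: etrans (restrE _ _) _; congr dsum_in; apply: esym.
exact: (ncomp_nat u (qhom (restr_hom (X := Qset X) f s)) y).
Qed.

Lemma cmap_bdry q (x : D F q.+1) : cmap q (bdry F q x) = bdry G q (cmap q.+1 x).
Proof.
rewrite raddf_sum; apply: eq_bigr => i _.
by rewrite raddfMz raddfB !cmap_restr.
Qed.

Lemma cmap_surj : (forall a y, exists x, u a x = y) ->
  forall q y, exists x, cmap q x = y.
Proof. by move=> surj q y; apply: dsum_map_lift => s; exact: surj. Qed.
End Map.

Lemma cmap_exact (F G H : functor) (u : ab_nat F G) (v : ab_nat G H) :
  (forall a x, v a x = 0 <-> exists y, u a y = x) ->
  forall q x, cmap v q x = 0 <-> exists y, cmap u q y = x.
Proof.
move=> ex q x; split=> [vx|[y <-]].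
  by apply: dsum_map_lift => s; apply/ex; exact: (congr1 (fun z : D H q => z s) vx).
by apply: dsum_eqP => s; apply/ex; exists (y s).
Qed.

Section Augmentation.
Variable F : functor.

Definition aug q : {additive D F q -> colim F} :=
  dsum_lift (fun s : qcell X q => colim_in F (qpt s)).

Lemma aug_restr m n (f : box_hom m n) x : aug m (restr (qsys F) f x) = aug n x.
Proof.
apply: (@dsum_ext _ _ _ (aug m \o restr (qsys F) f) (aug n)) => s y.
apply: etrans (congr1 (aug m) (restrE _ _)) _; apply: etrans (dsum_liftE _ _) _.
by apply: esym; apply: etrans (dsum_liftE _ _) _; apply: esym; exact: colim_inE.
Qed.

(** Opposite faces have the same augmentation, so they cancel in pairs. *)
Lemma aug_bdry q x : aug q (bdry F q x) = 0.
Proof.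
by rewrite raddf_sum big1 // => i _; rewrite raddfMz raddfB !aug_restr subrr mul0rz.
Qed.

Definition no_event (i : 'I_0) : E := False_rect E (Bool.diff_false_true (ltn_ord i)).

Definition vertex (x : X) : qcell X 0 :=
  @QCell _ _ _ X 0 x no_event (fun i : 'I_0 => False_rect _ (Bool.diff_false_true (ltn_ord i)))
    (fun i : 'I_0 => False_rect _ (Bool.diff_false_true (ltn_ord i))).

Lemma vertexE (s : qcell X 0) : s = vertex (qpt s).
Proof. by apply: qcell_eq => // -[]. Qed.

Definition edge (x : X) (e : E) : qcell X 1.
Proof. by refine (@QCell _ _ _ X 1 x (fun=> e) _ _) => i j; rewrite !ord1. Defined.

Definition vertex_in (x : X) : {additive F x -> D F 0} :=
  (@dsum_in (qcell X 0) (fun s => F (qpt s)) (vertex x) :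
     {additive _ -> dsum (fun s : qcell X 0 => F (qpt s))}).

(** The end point [z] is a parameter because the lower end [act x 1] equals [x] only by proof; the
    identity morphism then covers that end. *)
Lemma restr_edge (x z : X) e b (f : @Defs.hom (act_category X) x z) y :
  sval f = (if b then trace_of I [:: e] else 1%g) ->
  restr (qsys F) (face ord0 b)
    (@dsum_in (qcell X 1) (fun s => F (qpt s)) (edge x e) y) = vertex_in z (fmap F f y).
Proof.
move=> fE; apply: etrans (restrE _ _) _.
have cE : qmap (face ord0 b) (edge x e) = vertex z.
  by rewrite [LHS]vertexE qmap_face_pt -fE (svalP f).
pose h : @Defs.hom (elements (Qset X)) (cell (X := Qset X) (vertex z))
  (cell (X := Qset X) (edge x e)) := exist _ (face ord0 b) cE.
apply: etrans (restr_inE (G := qsys F) _ (h := h) erefl) _.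
congr dsum_in; congr (fmap F _ y); apply: act_hom_eq.
by rewrite fE; exact: ones_face.
Qed.

Lemma bdry_edge (x z : X) e (f : @Defs.hom (act_category X) x z) y :
  sval f = trace_of I [:: e] ->
  bdry F 0 (@dsum_in (qcell X 1) (fun s => F (qpt s)) (edge x e) y)
    = vertex_in x y - vertex_in z (fmap F f y) :> D F 0.
Proof.
move=> fE; rewrite [LHS]big_ord1 (restr_edge (b := true) _ fE).
rewrite (restr_edge (b := false) (f := idm (x : act_category X))) // fmap_id.
by rewrite expr1 mulrN1z opprB.
Qed.

(** A morphism factors along a word into single events, and each event is the boundary relation of
    an edge. *)
Lemma coker_vertex (x z : X) (f : @Defs.hom (act_category X) x z) y :
  coker_pi (bdry F 0) (vertex_in z (fmap F f y)) = coker_pi (bdry F 0) (vertex_in x y).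
Proof.
have [u fE] : exists u, sval f = trace_of I u by exists (repr (sval f)); rewrite trace_ofK.
elim: u x f fE y => [|e u IH] x f fE y.
  have xz : x = z by rewrite -(svalP f) fE trace_of_nil act1.
  case: z / xz f fE => f fE; rewrite (_ : f = idm (x : act_category X)) ?fmap_id //.
  exact: act_hom_eq.
pose g : @Defs.hom (act_category X) x (act x (trace_of I [:: e])) :=
  exist _ (trace_of I [:: e]) erefl.
have hP : act (act x (trace_of I [:: e])) (trace_of I u) = z.
  by rewrite -actM -trace_of_cat -fE (svalP f).
pose h : @Defs.hom (act_category X) _ z := exist _ (trace_of I u) hP.
have -> : f = g ;; h by apply: act_hom_eq; rewrite fE -[e :: u]cat1s trace_of_cat.
rewrite fmap_comp IH //; apply/eqP; rewrite eq_sym -subr_eq0 -raddfB; apply/eqP/coker_pi_eq0.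
by eexists; apply: (bdry_edge (f := g)).
Qed.

(** By [coker_vertex] the vertex inclusions form a cocone, and the induced map from the colimit to
    the cokernel, composed with [aug], is the projection to the cokernel. *)
Lemma aug_exact x : aug 0 x = 0 <-> exists y, bdry F 0 y = x.
Proof.
split=> [x0|[y <-]]; last exact: aug_bdry.
apply/coker_pi_eq0.
pose h (a : act_category X) : {additive F a -> coker (bdry F 0)} :=
  coker_pi (bdry F 0) \o vertex_in a.
have hF a b (f : @Defs.hom (act_category X) a b) y : h b (fmap F f y) = h a y.
  exact: coker_vertex.
rewrite -[0](raddf0 (colim_desc hF)) -x0.
apply: (@dsum_ext _ _ _ (coker_pi (bdry F 0)) (colim_desc hF \o aug 0)) => s y.
apply: esym; apply: etrans (congr1 (colim_desc hF) (dsum_liftE _ _)) _.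
apply: etrans (colim_descE hF _) _; congr (coker_pi _ _).
by move: y; rewrite [s]vertexE.
Qed.

Lemma aug_surj z : exists x, aug 0 x = z.
Proof.
have [y <-] := coker_pi_surj z.
apply: (dsum_ind (P := fun y => exists x, aug 0 x = coker_pi (colim_rel F) y))
  => [y1 y2 [x1 e1] [x2 e2]|a y'|].
- by exists (x1 - x2); rewrite !raddfB e1 e2.
- by exists (vertex_in a y'); exact: dsum_liftE.
- by exists 0; rewrite !raddf0.
Qed.
End Augmentation.

(** * Right exactness of the colimit and dimension shifting *)

Lemma aug_nat (F G : functor) (u : ab_nat F G) q x :
  aug G q (cmap u q x) = colim_map u (aug F q x).
Proof.
apply: (@dsum_ext _ _ _ (aug G q \o cmap u q) (colim_map u \o aug F q)) => s y.
apply: etrans (congr1 (aug G q) (dsum_map_in _ _)) _; apply: etrans (dsum_liftE _ _) _.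
apply: esym; apply: etrans (congr1 (colim_map u) (dsum_liftE _ _)) _.
exact: colim_mapE.
Qed.

Lemma colim_map_surj (G H : functor) (v : ab_nat G H) :
  (forall a y, exists x, v a x = y) -> forall z, exists w, colim_map v w = z.
Proof.
move=> surj z; have [x <-] := aug_surj z; have [y <-] := cmap_surj surj x.
by exists (aug G 0 y); rewrite aug_nat.
Qed.

(** The colimit is the cokernel of [bdry] in degree 0, and the chain groups are exact in the
    coefficients. *)
Lemma colim_right_exact (F G H : functor) (u : ab_nat F G) (v : ab_nat G H) :
  (forall a x, v a x = 0 <-> exists y, u a y = x) -> (forall a y, exists x, v a x = y) ->
  forall z, colim_map v z = 0 <-> exists w, colim_map u w = z.
Proof.
move=> ex surj z; split=> [|[w <-]].
  have [x <-] := aug_surj z; rewrite -aug_nat => /aug_exact[y].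
  have [{}y <-] := cmap_surj surj y; rewrite -[bdry _ _ _]cmap_bdry => /eqP.
  rewrite eq_sym -subr_eq0 -raddfB => /eqP/(cmap_exact ex)[w wE].
  by exists (aug F 0 w); rewrite -aug_nat wE raddfB aug_bdry subr0.
have [x <-] := aug_surj w; rewrite -!aug_nat.
by rewrite (_ : cmap v 0 _ = 0) ?raddf0 //; apply/(cmap_exact ex); exists x.
Qed.

(* The isomorphism is inverse to the connecting homomorphism of
   0 -> ker -> P -> F -> 0; it is given by the zigzag relation between a cycle
   [a] and the image [c] of a chain [b] of P with boundary [a]. *)
Lemma homology_shift (F : functor) q :
  zmod_iso (homology (cubical_complex (qsys (ker_functor (free_counit F)))) q.+1)
    (homology (cubical_complex (qsys F)) q.+2).
Proof.
set K := ker_functor _; pose P := free_functor F.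
pose p := cmap (free_counit F); pose i := cmap (ker_nat (free_counit F)).
have p_surj n y : exists x, p n x = y by apply: cmap_surj; exact: free_counit_surj.
have ex n x : p n x = 0 <-> exists y, i n y = x.
  apply: cmap_exact => a w; split=> [/eqP w0|[v <-]]; last exact: ker_valE.
  by exists (Ker w0 : K a).
have i_inj n : injective (i n).
  move=> x y xy; apply: dsum_eqP => s; apply: val_inj.
  exact: (congr1 (fun z : D P n => z s) xy).
have pN n x : p n (bdry P n x) = bdry F n (p n.+1 x) by exact: cmap_bdry.
have iN n x : i n (bdry K n x) = bdry P n (i n.+1 x) by exact: cmap_bdry.
have pi n x : p n (i n x) = 0 by apply/ex; exists x.
have acyc n x : bdry P n x = 0 -> exists y, bdry P n.+1 y = x by exact: free_acyclic.
apply: (@homology_rel_iso (cubical_complex (qsys K)) (cubical_complex (qsys F)) q q.+1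
  (fun a c => exists2 b, i q.+1 a = bdry P q.+1 b & p q.+2 b = c)).
- move=> a c a' c' [b ab bc] [b' ab' bc']; exists (b - b'); first by rewrite !raddfB ab ab'.
  by rewrite raddfB bc bc'.
- move=> a a0; have [|b bE] := acyc q (i q.+1 a); first by rewrite -iN [bdry _ _ _]a0 raddf0.
  exists (p q.+2 b); last by exists b.
  by rewrite -[LHS]pN bE pi.
- move=> c c0; have [b bc] := p_surj _ c.
  have /ex[a aE] : p q.+1 (bdry P q.+1 b) = 0 by rewrite pN bc.
  exists a; last by exists b.
  by apply: i_inj; rewrite [LHS]iN aE raddf0 [LHS]bdry_bdry.
- move=> a c [b ab bc]; split=> -[x xE].
    have /acyc[y yE] : bdry P q.+1 (b - i q.+2 x) = 0.
      by rewrite raddfB -ab -iN [bdry K _ _]xE subrr.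
    by exists (p q.+3 y); rewrite -[LHS]pN yE raddfB pi subr0.
  have [y yx] := p_surj _ x.
  have /ex[w wE] : p q.+2 (b - bdry P q.+2 y) = 0.
    by rewrite raddfB pN yx [bdry F _ _]xE bc subrr.
  exists w; apply: i_inj; rewrite [LHS]iN wE raddfB -ab [X in _ - X]bdry_bdry subr0.
  by [].
Qed.

Lemma homology_syzygy (F : functor) n q :
  zmod_iso (homology (cubical_complex (qsys (syzygy F n))) q.+1)
    (homology (cubical_complex (qsys F)) (n + q).+1).
Proof.
elim: n q => [|n IH] q; first by exists idfun; exists id.
by apply: zmod_iso_trans (homology_shift (syzygy F n) q) _; rewrite addSnnS; exact: IH.
Qed.

(** A zigzag in the double complex of cubical chains of the resolution: lift [z] to a 0-chain [x];
    its image under [b] has augmentation 0, hence bounds a 1-chain [y], whose image in the syzygy is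
    [c]. *)
Lemma colim_homology1 (F : functor) n :
  zmod_iso (homology (colim_complex (std_resolution F)) n.+1)
    (homology (cubical_complex (qsys (syzygy F n))) 1).
Proof.
pose K := syzygy F n; pose P m := free_functor (syzygy F m).
pose p := cmap (free_counit K); pose b m := cmap (@std_bd _ F m).
have p_surj q y : exists x, p q x = y by apply: cmap_surj; exact: free_counit_surj.
have exp q x : p q x = 0 <-> exists y, b n q y = x by apply: cmap_exact; exact: std_bd_im.
have exb m q x : b m q x = 0 <-> exists y, b m.+1 q y = x.
  by apply: cmap_exact; exact: std_bd_exact.
have pN q x : p q (bdry (P n) q x) = bdry K q (p q.+1 x) by exact: cmap_bdry.
have bN m q x : b m q (bdry (P m.+1) q x) = bdry (P m) q (b m q.+1 x) by exact: cmap_bdry.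
have pb q x : p q (b n q x) = 0 by apply/exp; exists x.
have aN m x : colim_map (@std_bd _ F m) (aug (P m.+1) 0 x) = aug (P m) 0 (b m 0 x).
  by rewrite aug_nat.
have acyc q x : bdry (P n) q x = 0 -> exists y, bdry (P n) q.+1 y = x by exact: free_acyclic.
apply: (@homology_rel_iso (colim_complex (std_resolution F)) (cubical_complex (qsys K)) n 0
  (fun z c => exists x y, [/\ aug (P n.+1) 0 x = z, p 1 y = c
    & b n 0 x = bdry (P n) 0 y])).
- move=> z c z' c' [x [y [xz yc xy]]] [x' [y' [xz' yc' xy']]].
  by exists (x - x'), (y - y'); split; rewrite !raddfB ?xz ?yc ?xy ?xz' ?yc' ?xy'.
- move=> z z0; have [x xz] := aug_surj z.
  have /aug_exact[y yE] : aug (P n) 0 (b n 0 x) = 0 by rewrite -aN xz.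
  exists (p 1 y); last by exists x, y.
  by rewrite -[LHS]pN yE pb.
- move=> c c0; have [y yc] := p_surj _ c.
  have /exp[x xE] : p 0 (bdry (P n) 0 y) = 0 by rewrite pN yc.
  exists (aug (P n.+1) 0 x); last by exists x, y.
  by rewrite [LHS]aN xE [LHS]aug_bdry.
- move=> z c [x [y [xz yc xy]]]; split=> -[w wE].
    have [x' xw] := aug_surj w.
    have /aug_exact[t tE] : aug (P n.+1) 0 (x - b n.+1 0 x') = 0.
      by rewrite raddfB -aN xw xz [X in _ - X]wE subrr.
    (* Subtracting [b n 1 t] turns [y] into a cycle without changing its image [c]. *)
    have /acyc[s sE] : bdry (P n) 0 (y - b n 1 t) = 0.
      rewrite raddfB -xy -bN tE raddfB opprB addrC subrK.
      by apply/exb; exists x'.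
    by exists (p 2 s); rewrite -[LHS]pN sE raddfB pb subr0.
  have [y' yw] := p_surj _ w.
  have /exp[t tE] : p 1 (y - bdry (P n) 1 y') = 0.
    by rewrite raddfB pN yw [X in _ - X]wE yc subrr.
  (* Correcting [x] by a boundary keeps its augmentation [z] and puts it in the image of the next
     differential. *)
  have /exb[x' xE] : b n 0 (x - bdry (P n.+1) 0 t) = 0.
    by rewrite raddfB bN tE raddfB xy [X in _ - (_ - X)]bdry_bdry subr0 subrr.
  exists (aug (P n.+2) 0 x'); rewrite [LHS]aN xE raddfB xz [X in _ - X]aug_bdry.
  by rewrite subr0.
Qed.

Theorem colim_derived_cubical (F : functor) n :
  zmod_iso (colim_derived F n) (cubical_homology (qsys F) n).
Proof.
case: n => [|n].
  (* In degree 0 both groups are cokernels isomorphic to the colimit of [F]. *)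
  apply: (@zmod_iso_trans _ (colim F)).
    apply: (coker_iso (g := colim_map (free_counit F))).
      exact: colim_map_surj (@free_counit_surj _ F).
    exact: colim_right_exact (@std_bd_im _ F 0) (@free_counit_surj _ F).
  apply/zmod_iso_sym/(coker_iso (g := aug F 0)); first exact: aug_surj.
  exact: aug_exact.
(* In positive degree both groups reduce to the first cubical homology of the [n]-th syzygy. *)
apply: zmod_iso_trans (colim_homology1 F n) _.
by have := homology_syzygy F n 0; rewrite addn0.
Qed.
End Cubical_chains.

Theorem corollary3p5 (d : Order.disp_t) (S : Type) (E : orderType d)
    (Sigma : state_space S E) (F : ab_functor (state_category Sigma)) :
  locally_finite_dimensional (indep Sigma) ->
  forall n : nat,
    zmod_iso (state_homology F n) (cubical_homology (qsys F) n).
Proof.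
move=> _ n.
exact: (colim_derived_cubical (@indep_irr _ _ Sigma) (@indep_sym _ _ Sigma) F n).
Qed.
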